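(* Let $u,m\ge2$ be integers, $n=u+m$, and let $Z$ be uniform over the $u$-element subsets of $[n]$ with $\bar Z=[n]\setminus Z$. Let $\mathcal H$ be a nonempty class of real-valued functions on $[n]$, and let $H_0>0$ satisfy $|h(i)|\le H_0$ for every $h\in\mathcal H$ and $i\in[n]$. Fix $K_0>1$, and let $\tilde T_n:\mathcal H\to[0,\infty)$ be a functional satisfying $T_n(h)\le\tilde T_n(h)$ for every $h\in\mathcal H$. For $r>0$ put $$\mathcal H(r)=\{h\in\mathcal H:\tilde T_n(h)\le r\}\cup\{0\},\qquad \mathcal H^2(r)=\{h^2:h\in\mathcal H,\ \tilde T_n(h)\le r\}\cup\{0\},$$ where $0$ is the zero function. Let $\psi_{u,m}$ be a sub-root function with positive fixed point $r_{u,m}$, and suppose that, for every $r\ge r_{u,m}$, $$\psi_{u,m}(r)\ge\max_{p\in\{u,m\},\ \eta\in\{+,-\}}\max\big\{\mathfrak R_p^\eta(\mathcal H(r)),\ \mathfrak R_p^\eta(\mathcal H^2(r))\big\}.$$ Set $c_0=\sqrt{219}$, $d_0=4+4c_0/7$, $c_1=8K_0d_0^2$, and $c_2=8K_0c_0^2+32H_0+c_0$. Then, for every $x>0$, with probability at least $1-\exp(-x)$ over $Z$, simultaneously for all $h\in\mathcal H$, $$\mathcal L_h(Z)\le\mathcal L_h(\bar Z)+\frac{\tilde T_n(h)}{K_0}+c_1r_{u,m}+\frac{c_2x}{N_{u,m}}.$$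
   Context: $[n]=\{1,\dots,n\}$ and $N_{u,m}=\min\{u,m\}$. For $h:[n]\to\mathbb R$ and nonempty $\mathcal A\subseteq[n]$, $\mathcal L_h(\mathcal A)=|\mathcal A|^{-1}\sum_{i\in\mathcal A}h(i)$; $\mathcal L_n(h)=\mathcal L_h([n])$; $T_n(h)=n^{-1}\sum_{i=1}^n h(i)^2$. For a nonempty class $\mathcal A$ of functions on $[n]$, the transductive complexities are $\mathfrak R_u^{\pm}(\mathcal A)=\mathbb E\big[\sup_{h\in\mathcal A}\pm(\mathcal L_h(Z)-\mathcal L_n(h))\big]$ and $\mathfrak R_m^{\pm}(\mathcal A)=\mathbb E\big[\sup_{h\in\mathcal A}\pm(\mathcal L_h(\bar Z)-\mathcal L_n(h))\big]$, expectations over $Z$. A function $\psi:[0,\infty)\to[0,\infty)$ is sub-root if it is nonnegative, nondecreasing, and $r\mapsto\psi(r)/\sqrt r$ is nonincreasing on $(0,\infty)$; a fixed point is a positive number $r^*$ with $\psi(r^* )=r^*$. *)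

(* Defs.v *)
From HB Require Import structures.
From mathcomp Require Import all_boot all_order all_algebra.
From mathcomp Require Import all_classical all_reals all_analysis.

Set Implicit Arguments.
Unset Strict Implicit.
Unset Printing Implicit Defensive.

Import Order.TTheory GRing.Theory Num.Theory.

Local Open Scope classical_set_scope.
Local Open Scope ring_scope.

(* The ground set [n] = {1, ..., n} is represented by 'I_n = {0, ..., n-1}. *)

(* L_h(A); only meaningful for nonempty A. *)
Definition avg (R : realType) (n : nat) (h : 'I_n -> R) (A : {set 'I_n}) : R :=
  #|A|%:R^-1 * \sum_(i in A) h i.

(* L_n(h) *)
Definition avgn (R : realType) (n : nat) (h : 'I_n -> R) : R :=
  avg h (finset.setTfor 'I_n).

(* T_n(h) *)
Definition second_moment (R : realType) (n : nat) (h : 'I_n -> R) : R :=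
  n%:R^-1 * \sum_(i < n) h i ^+ 2.

(* Expectation of f(Z) for Z uniform over the u-element subsets of [n]. *)
Definition Eunif (R : realType) (n u : nat) (f : {set 'I_n} -> R) : R :=
  (\sum_(Z : {set 'I_n} | #|Z| == u) f Z)
    / #|[pred Z : {set 'I_n} | #|Z| == u]|%:R.

(* Probability of the event E(Z) for the same Z. *)
Definition Punif (R : realType) (n u : nat) (E : {set 'I_n} -> Prop) : R :=
  #|[pred Z : {set 'I_n} | (#|Z| == u) && `[< E Z >]]|%:R
    / #|[pred Z : {set 'I_n} | #|Z| == u]|%:R.

(* The complexities R_u^{+/-} and R_m^{+/-} of a class A of functions on
   [n], where n = u + m; the sign is eta = 1 or eta = -1.  Both expectations
   are over Z uniform of cardinality u, the second one averaging over the
   complement of Z.  The real-valued sup is the true supremum as soon as A is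
   nonempty and uniformly bounded. *)
Definition complexity_u (R : realType) (n u : nat) (eta : R)
    (A : set ('I_n -> R)) : R :=
  Eunif u (fun Z => sup [set eta * (avg h Z - avgn h) | h in A]).

Definition complexity_m (R : realType) (n u : nat) (eta : R)
    (A : set ('I_n -> R)) : R :=
  Eunif u (fun Z => sup [set eta * (avg h (~: Z) - avgn h) | h in A]).

(* max over p in {u, m} and eta in {+, -} of
   max (R_p^eta(A), R_p^eta(B)) *)
Definition max_complexity (R : realType) (n u : nat)
    (A B : set ('I_n -> R)) : R :=
  Num.max
    (Num.max
       (Num.max (complexity_u u 1 A) (complexity_u u 1 B))
       (Num.max (complexity_u u (-1) A) (complexity_u u (-1) B)))
    (Num.max
       (Num.max (complexity_m u 1 A) (complexity_m u 1 B))
       (Num.max (complexity_m u (-1) A) (complexity_m u (-1) B))).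

(* H(r) *)
Definition sublevel (R : realType) (n : nat) (H : set ('I_n -> R))
    (T : ('I_n -> R) -> R) (r : R) : set ('I_n -> R) :=
  [set h | H h /\ T h <= r] `|` [set (fun=> 0)].

(* H^2(r) *)
Definition sq_sublevel (R : realType) (n : nat) (H : set ('I_n -> R))
    (T : ('I_n -> R) -> R) (r : R) : set ('I_n -> R) :=
  [set (fun i => h i ^+ 2) | h in [set h | H h /\ T h <= r]]
    `|` [set (fun=> 0)].

(* A function [0, oo) -> [0, oo) is represented by a function on R whose
   values at negative arguments are irrelevant. *)
Definition sub_root (R : realType) (psi : R -> R) : Prop :=
  [/\ forall r, 0 <= r -> 0 <= psi r,
      forall r s, 0 <= r -> r <= s -> psi r <= psi s &
      forall r s, 0 < r -> r <= s ->
        psi s / Num.sqrt s <= psi r / Num.sqrt r].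

(* Main.v *)
(** Write n = u + m and N = min(u, m). Sampling without replacement satisfies the
    modified log-Sobolev inequality Ent(f) <= (N/2) E(f, ln f), where E averages
    (f(Z) - f(Z')) (ln f(Z) - ln f(Z')) over the sets Z' obtained from Z by one
    swap. It follows by revealing the sample one point at a time: the chain rule
    for the entropy reduces it to the one-point entropies, and the joint convexity
    of (a, b) |-> (a - b)(ln a - ln b), applied to a coupling of the two
    conditional samples, bounds these by the swap energy.

    Let q be the excess c1 r_{u,m} + c2 x / N of the theorem and r = 4 K0 q. For
    every bad sample Z pick a violating h_Z, let k be the least level with
    T(h_Z) <= 4^k r, and rescale h_Z by 4^-k. If Z is bad, then the supremum g of
    L_phi(Z) - L_phi(complement of Z) over this finite rescaled family exceeds q.
    Peeling and the sub-root property bound E g by q/4 and the expectation of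
    W = sup (L_{phi^2}(Z) + L_{phi^2}(complement of Z)) by 3r. The log-Sobolev
    inequality gives Ent(e^{sg}) <= (8 s^2 / N) E[W e^{sg}] and
    Ent(e^{sW}) <= (s^2 H0^2 / N) E[W e^{sW}]. Herbst's argument turns the second
    into a bound on the moment generating function of W; the variational formula
    for the entropy then removes W from the first, and Herbst's argument and
    Chernoff's bound finish the proof. *)
Require Import Defs.
From HB Require Import structures.
From mathcomp Require Import all_boot all_order all_algebra.
From mathcomp Require Import all_classical all_reals all_analysis.
From mathcomp Require Import ring lra zify.

Set Implicit Arguments.
Unset Strict Implicit.
Unset Printing Implicit Defensive.

Import Order.TTheory GRing.Theory Num.Theory.

Local Open Scope classical_set_scope.
Local Open Scope ring_scope.

(** * The symmetrized relative entropy (a - b)(ln a - ln b) *)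

Section LogDifference.
Variable R : realType.
Implicit Types a b : R.

Lemma ln_le_subr1 a : 0 < a -> ln a <= a - 1.
Proof. by move=> a0; rewrite -{1}(subrKC 1 a) le_ln1Dx//; lra. Qed.

Definition log_diff a b := (a - b) * (ln a - ln b).

Lemma log_diffxx a : log_diff a a = 0.
Proof. by rewrite /log_diff subrr mul0r. Qed.

Lemma log_diff_ge0 a b : 0 < a -> 0 < b -> 0 <= log_diff a b.
Proof.
move=> a0 b0; rewrite /log_diff; have [ab|/ltW ab] := leP a b.
  by rewrite mulr_le0// subr_le0// ler_ln.
by rewrite mulr_ge0// subr_ge0// ler_ln.
Qed.

Lemma log_diff_homo (c : R) a b : 0 < c -> 0 < a -> 0 < b ->
  log_diff (c * a) (c * b) = c * log_diff a b.
Proof.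
by move=> c0 a0 b0; rewrite /log_diff !lnM ?posrE//; ring.
Qed.

(** The left side is the tangent plane of [log_diff] at [(A, B)]; it has no constant term because
    [log_diff] is homogeneous of degree one. Both [a (ln a - ln b)] and [b (ln b - ln a)] are
    bounded below through [ln t <= t - 1]. *)
Lemma log_diff_tangent A B a b : 0 < A -> 0 < B -> 0 < a -> 0 < b ->
  (a - b) * (ln A - ln B) + (a - b * A / B) + (b - a * B / A) <= log_diff a b.
Proof.
move=> A0 B0 a0 b0; rewrite /log_diff.
have key (x y X Y : R) : 0 < x -> 0 < y -> 0 < X -> 0 < Y ->
    x * (ln X - ln Y) + (x - y * X / Y) <= x * (ln x - ln y).
  move=> x0 y0 X0 Y0.
  have q0 : 0 < X * y / (Y * x) by rewrite divr_gt0 ?mulr_gt0.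
  have := ln_le_subr1 q0.
  rewrite ln_div ?posrE ?mulr_gt0// !lnM ?posrE// -(ler_pM2l x0).
  have -> : x * (X * y / (Y * x) - 1) = y * X / Y - x.
    by field; rewrite !gt_eqF.
  lra.
have := key a b A B a0 b0 A0 B0; have := key b a B A b0 a0 B0 A0.
lra.
Qed.

(** Joint convexity in homogeneous form: both summands lie above the tangent plane taken at their
    sum, where it is exact. *)
Lemma log_diff_subadd a b a' b' : 0 < a -> 0 < b -> 0 < a' -> 0 < b' ->
  log_diff (a + a') (b + b') <= log_diff a b + log_diff a' b'.
Proof.
move=> a0 b0 a0' b0'.
have A0 : 0 < a + a' by rewrite addr_gt0.
have B0 : 0 < b + b' by rewrite addr_gt0.
apply: le_trans (lerD (log_diff_tangent A0 B0 a0 b0)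
  (log_diff_tangent A0 B0 a0' b0')).
rewrite /log_diff.
have -> : forall A B X Y : R, 0 < A -> 0 < B ->
    (a - b) * (X - Y) + (a - b * A / B) + (b - a * B / A)
    + ((a' - b') * (X - Y) + (a' - b' * A / B) + (b' - a' * B / A))
    = (a + a' - (b + b')) * (X - Y) + ((a + a') - (b + b') * A / B)
      + ((b + b') - (a + a') * B / A) by move=> *; ring.
- by rewrite mulrAC mulfV ?gt_eqF// mulrAC mulfV ?gt_eqF// !mul1r; lra.
- exact: A0.
- exact: B0.
Qed.

(** The common term costs nothing since [log_diff c c = 0], and it keeps the arguments positive when
    the sums are empty. In the coupling below, [c] is the value at the set containing both [i] and
    [j]. *)
Lemma log_diff_sum (I : finType) (P : pred I) (c : R) (F G : I -> R) : 0 < c ->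
  (forall i, P i -> 0 < F i) -> (forall i, P i -> 0 < G i) ->
  log_diff (c + \sum_(i | P i) F i) (c + \sum_(i | P i) G i)
    <= \sum_(i | P i) log_diff (F i) (G i).
Proof.
move=> c0 F0 G0.
have : 0 <= \sum_(i | P i) F i /\ 0 <= \sum_(i | P i) G i /\
  log_diff (c + \sum_(i | P i) F i) (c + \sum_(i | P i) G i)
    <= \sum_(i | P i) log_diff (F i) (G i); last by case=> _ [].
elim/big_rec3: _ => [|i z y x Pi [y0 [x0 IH]]].
  by rewrite !addr0 log_diffxx.
have Fi := F0 _ Pi; have Gi := G0 _ Pi.
split; first by rewrite addr_ge0// ltW.
split; first by rewrite addr_ge0// ltW.
rewrite addrCA (addrCA c (G i)).
have h1 : 0 < c + y by lra.
have h2 : 0 < c + x by lra.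
by apply: le_trans (log_diff_subadd Fi Gi h2 h1) _; lra.
Qed.

(** Uses [1 - exp (- d) <= d]. The positive parts charge a pair to its larger value only, so that
    later only swaps that decrease the supremum count. *)
Lemma log_diff_expR_le (s a b : R) : 0 <= s ->
  log_diff (expR (s * a)) (expR (s * b))
  <= s ^+ 2 * (expR (s * a) * Num.max (a - b) 0 ^+ 2)
   + s ^+ 2 * (expR (s * b) * Num.max (b - a) 0 ^+ 2).
Proof.
move=> s0; wlog ab : a b / b <= a => [hw|].
  have [|/ltW ab] := leP b a; first exact: hw.
  by rewrite addrC; apply: le_trans (hw b a ab); rewrite /log_diff; lra.
rewrite /log_diff !expRK (max_idPl _) ?subr_ge0// (max_idPr _) ?subr_le0//.
rewrite expr0n/= !mulr0 addr0 -mulrBr.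
have -> : expR (s * b) = expR (s * a) * expR (- (s * (a - b))).
  by rewrite -expRD; congr expR; ring.
have d0 : 0 <= s * (a - b) by rewrite mulr_ge0// subr_ge0.
have h : 1 - expR (- (s * (a - b))) <= s * (a - b).
  by have := expR_ge1Dx (- (s * (a - b))); lra.
rewrite -{1}(mulr1 (expR (s * a))) -mulrBr.
have -> : s ^+ 2 * (expR (s * a) * (a - b) ^+ 2)
  = expR (s * a) * (s * (a - b)) * (s * (a - b)) by ring.
by rewrite ler_wpM2r// ler_wpM2l// expR_ge0.
Qed.

End LogDifference.

(** * Entropy and the Herbst argument on a finite probability space *)

Section FiniteProbability.
Variables (R : realType) (I : finType) (p : I -> R).
Hypothesis p_ge0 : forall i, 0 <= p i.
Hypothesis p_sum1 : \sum_i p i = 1.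
Implicit Types f g X W : I -> R.

Definition mean f : R := \sum_i p i * f i.

Definition entropy f : R :=
  mean (fun i => f i * ln (f i)) - mean f * ln (mean f).

Lemma mean_cst (c : R) : mean (fun=> c) = c.
Proof. by rewrite /mean -big_distrl/= p_sum1 mul1r. Qed.

Lemma le_mean f g : (forall i, f i <= g i) -> mean f <= mean g.
Proof. by move=> fg; apply: ler_sum => i _; rewrite ler_wpM2l. Qed.

Lemma meanD f g : mean (fun i => f i + g i) = mean f + mean g.
Proof. by rewrite /mean -big_split/=; apply: eq_bigr => i _; rewrite mulrDr. Qed.

Lemma meanZ (c : R) f : mean (fun i => c * f i) = c * mean f.
Proof. by rewrite /mean big_distrr/=; apply: eq_bigr => i _; rewrite mulrCA. Qed.

Lemma mean_gt0 f : (forall i, 0 < f i) -> 0 < mean f.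
Proof.
move=> f0; have [i pi0] : exists i, p i != 0.
  apply/existsP; apply: contraTT isT; rewrite negb_exists => /forallP p0.
  have := p_sum1; rewrite big1 => [/esym/eqP|i _]; first by rewrite oner_eq0.
  by have := p0 i; rewrite negbK => /eqP.
rewrite /mean (bigD1 i)//= ltr_pwDl//.
  by rewrite mulr_gt0// lt_neqAle eq_sym pi0 p_ge0.
by apply: sumr_ge0 => j _; rewrite mulr_ge0// ltW.
Qed.

(** The Gibbs variational formula: with [F] and [G] the means of [f] and [expR W], average the
    pointwise bound [ln t <= t - 1] at [t = expR W * F / (f * G)]. *)
Lemma entropy_duality f W : (forall i, 0 < f i) ->
  mean (fun i => f i * W i)
  <= entropy f + mean f * ln (mean (fun i => expR (W i))).
Proof.
move=> f0; have F0 := mean_gt0 f0.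
have G0 := mean_gt0 (fun i => expR_gt0 (W i)).
set F := mean f in F0 *; set G := mean (fun i => expR (W i)) in G0 *.
have key i : f i * W i <= f i * ln (f i) + ((ln G - ln F - 1) * f i
                          + F / G * expR (W i)).
  have q0 : 0 < expR (W i) * F / (f i * G).
    by rewrite divr_gt0 ?mulr_gt0 ?expR_gt0.
  have := ln_le_subr1 q0.
  rewrite ln_div ?posrE ?mulr_gt0 ?expR_gt0// !lnM ?posrE ?expR_gt0// expRK.
  rewrite -(ler_pM2l (f0 i)).
  have -> : f i * (expR (W i) * F / (f i * G) - 1) = F / G * expR (W i) - f i.
    by field; rewrite !gt_eqF.
  lra.
apply: le_trans (le_mean key) _; rewrite !meanD !meanZ -/F -/G /entropy -/F.
by rewrite divfK ?gt_eqF//; lra.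
Qed.

Lemma is_derive_sum_seq (r : seq I) (f : I -> R -> R) (df : I -> R) (x : R) :
  (forall i, is_derive x 1 (f i) (df i)) ->
  is_derive x 1 (fun s => \sum_(i <- r) f i s) (\sum_(i <- r) df i).
Proof.
move=> h; elim: r => [|i r IH].
  rewrite big_nil; have -> : (fun s => \sum_(i <- [::]) f i s) = cst 0.
    by apply/funext => s; rewrite big_nil.
  exact: is_derive_cst.
rewrite big_cons.
have -> : (fun s => \sum_(j <- i :: r) f j s)
    = f i + (fun s => \sum_(j <- r) f j s).
  by apply/funext => s; rewrite big_cons.
exact: is_deriveD.
Qed.

Definition mgf X (s : R) : R := mean (fun i => expR (s * X i)).

Lemma mgf_gt0 X s : 0 < mgf X s.
Proof. by apply: mean_gt0 => i; exact: expR_gt0. Qed.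

Lemma is_derive_mgf X (s : R) :
  is_derive s 1 (mgf X) (mean (fun i => X i * expR (s * X i))).
Proof.
apply: is_derive_sum_seq => i.
have h : is_derive s 1 (fun t : R => t * X i) (X i).
  have -> : (fun t : R => t * X i) = X i *: (id : R -> R).
    by apply/funext => t; rewrite /GRing.scale/= mulrC.
  by apply: is_derive_eq; rewrite /GRing.scale/= mulr1.
have h2 := @is_derive1_comp R expR (fun t => t * X i) s _ _ (is_derive_expR _) h.
have -> : (fun t : R => p i * expR (t * X i))
    = p i *: (expR \o (fun t : R => t * X i)) by [].
by apply: is_derive_eq; rewrite /GRing.scale/= [X i * _]mulrC.
Qed.

Definition log_mgf X (s : R) : R := ln (mgf X s).

Lemma is_derive_log_mgf X (s : R) :
  is_derive s 1 (log_mgf X) (mean (fun i => X i * expR (s * X i)) / mgf X s).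
Proof.
have h := is_derive_mgf X s.
have := @is_derive1_comp R (@ln R) (mgf X) s _ _ (is_derive1_ln (mgf_gt0 X s)) h.
by rewrite mulrC.
Qed.

Lemma entropy_mgf X (s : R) : entropy (fun i => expR (s * X i))
  = s * mean (fun i => X i * expR (s * X i)) - mgf X s * log_mgf X s.
Proof.
rewrite /entropy -/(mgf X s) -/(log_mgf X s) -meanZ; congr (_ - _).
by apply: eq_bigr => i _; rewrite expRK; ring.
Qed.

(** Serves only the limit [s -> 0] in Herbst's argument, where any error of order [s^2] will do. *)
Lemma log_mgf_le_small X (M s : R) : (forall i, 0 <= X i <= M) ->
  0 <= s -> s * M <= 1 / 2 -> log_mgf X s <= s * mean X + 2 * M ^+ 2 * s ^+ 2.
Proof.
move=> XM s0 sM.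
apply: le_trans (ln_le_subr1 (mgf_gt0 X s)) _.
rewrite lerBlDr -meanZ -[X in _ <= _ + X + _]mean_cst -[X in _ <= _ + X]mean_cst.
rewrite -!meanD; apply: le_mean => i.
have /andP[X0 XMi] := XM i.
have y0 : 0 <= s * X i by rewrite mulr_ge0.
have yM : s * X i <= s * M by rewrite ler_wpM2l.
set y := s * X i in y0 yM *.
have y2 : y ^+ 2 <= M ^+ 2 * s ^+ 2.
  by rewrite -exprMn (mulrC M) lerXn2r ?nnegrE// (le_trans y0).
(* On [[0, 1/2]], [(1 - y) (1 + y + 2 y^2) >= 1 >= (1 - y) exp y]. *)
apply: (@le_trans _ _ (1 + y + 2 * y ^+ 2)); last by lra.
have := expR_ge1Dx (- y); rewrite expRN => h.
have e0 := expR_gt0 y.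
have h' : (1 - y) * expR y <= 1 by rewrite -ler_pdivlMr// div1r.
have h1y : 0 < 1 - y by lra.
rewrite -(ler_pM2l h1y); apply: le_trans h' _.
have -> : (1 - y) * (1 + y + 2 * y ^+ 2) = 1 + y ^+ 2 * (1 - 2 * y) by ring.
by rewrite lerDl mulr_ge0// ?sqr_ge0//; lra.
Qed.

(* Herbst's argument: [s |-> log_mgf X s / s - a s - b log_mgf X s] is
   nonincreasing and tends to the mean of [X] at 0. *)
Lemma herbst X (a b l : R) : (forall i, 0 <= X i) -> 0 <= a -> 0 <= b -> 0 < l ->
  (forall s, 0 < s <= l -> entropy (fun i => expR (s * X i))
     <= s ^+ 2 * (a * mgf X s + b * mean (fun i => X i * expR (s * X i)))) ->
  log_mgf X l / l <= mean X + a * l + b * log_mgf X l.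
Proof.
move=> X0 a0 b0 l0 hent.
pose psi := fun s : R => log_mgf X s / s - a * s - b * log_mgf X s.
pose dpsi := fun s : R => let F := mgf X s in
  let F1 := mean (fun i => X i * expR (s * X i)) in
  (F1 / F / s - log_mgf X s / s ^+ 2) - a - b * (F1 / F).
have dpsiP (s : R) : 0 < s -> is_derive s 1 psi (dpsi s).
  move=> s0; have dK := is_derive_log_mgf X s.
  have dV : is_derive s 1 (fun t : R => t^-1) (- s ^- 2).
    have := @is_deriveV R id s 1 1 (lt0r_neq0 s0) (is_derive_id s 1).
    by rewrite /GRing.scale/= mulr1.
  have := @is_deriveB _ _ _ _ _ _ _ _ _
     (@is_deriveB _ _ _ _ _ _ _ _ _ (is_deriveM dK dV)
        (is_deriveZ a (is_derive_id s (1 : R))))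
     (is_deriveZ b dK).
  move=> h; apply: (@is_derive_eq _ _ _ _ _ _ _ _ h).
  by rewrite /dpsi /GRing.scale/=; ring.
have dpsi_le0 (s : R) : 0 < s <= l -> dpsi s <= 0.
  move=> /andP[s0 sl]; have := hent s; rewrite s0 sl => /(_ isT).
  rewrite entropy_mgf /dpsi /=; have F0 := mgf_gt0 X s.
  set F := mgf X s in F0 *; set F1 := mean _; set K := log_mgf X s => h.
  (* Multiplied by [s^2 F], the derivative is the entropy minus its assumed bound. *)
  have c0 : 0 < s ^+ 2 * F by rewrite mulr_gt0// exprn_gt0.
  rewrite -(pmulr_rle0 _ c0).
  have -> : s ^+ 2 * F * (F1 / F / s - K / s ^+ 2 - a - b * (F1 / F))
     = (s * F1 - F * K) - s ^+ 2 * (a * F + b * F1).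
    by field; rewrite !gt_eqF.
  by rewrite subr_le0.
have psi_le (s : R) : 0 < s <= l -> psi l <= psi s.
  move=> /andP[s0 sl].
  have pos (t : R) : t \in `[s, l]%R -> 0 < t.
    by rewrite in_itv/= => /andP[st _]; exact: lt_le_trans st.
  have sub (t : R) : t \in `]s, l[%R -> t \in `[s, l]%R.
    by rewrite !in_itv/= => /andP[/ltW -> /ltW ->].
  apply: (@ler0_derive1_le_cc R psi s l) => //.
  - by move=> t /sub /pos t0; have [] := dpsiP t t0.
  - move=> t /sub tI; rewrite derive1E; have [_ ->] := dpsiP t (pos t tI).
    apply: dpsi_le0; rewrite pos//=; by move: tI; rewrite in_itv/= => /andP[].
  - apply: derivable_within_continuous => t /pos t0.
    by have [] := dpsiP t t0.
  - by rewrite in_itv/= lexx sl.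
  - by rewrite in_itv/= sl lexx.
pose M : R := 1 + \sum_i X i.
have M0 : 0 < M by rewrite ltr_pwDl// sumr_ge0.
have XM i : 0 <= X i <= M.
  rewrite X0/= /M (bigD1 i)//=.
  have : 0 <= \sum_(j | j != i) X j by apply: sumr_ge0.
  lra.
suff : psi l <= mean X by rewrite /psi; lra.
apply/ler_addgt0Pr => e e0.
have d0 : 0 < e / (2 * M ^+ 2) by rewrite divr_gt0// mulr_gt0// exprn_gt0.
have d1 : 0 < (2 * M)^-1 by rewrite invr_gt0 mulr_gt0.
(* The last two entries force [s M <= 1/2] and [2 M^2 s <= e]. *)
pose s := Num.min l (Num.min (2 * M)^-1 (e / (2 * M ^+ 2))).
have s0 : 0 < s by rewrite !lt_min l0 d0 d1.
have sl : s <= l by rewrite ge_min lexx.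
have s1 : s * M <= 1 / 2.
  rewrite -ler_pdivlMr//; apply: (@le_trans _ _ (2 * M)^-1).
    by rewrite !ge_min lexx !orbT.
  by rewrite invfM mul1r.
have s2 : 2 * M ^+ 2 * s <= e.
  rewrite mulrC -ler_pdivlMr ?mulr_gt0 ?exprn_gt0//.
  by rewrite !ge_min lexx !orbT.
apply: le_trans (psi_le s _) _; first by rewrite s0.
have K0 : 0 <= log_mgf X s.
  apply: ln_ge0; rewrite -(mean_cst 1); apply: le_mean => i.
  by rewrite -expR0 ler_expR mulr_ge0// ltW.
have := log_mgf_le_small XM (ltW s0) s1.
have -> : s * mean X + 2 * M ^+ 2 * s ^+ 2 = (mean X + 2 * M ^+ 2 * s) * s by ring.
rewrite -ler_pdivrMr// /psi.
have : 0 <= a * s by rewrite mulr_ge0// ltW.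
have : 0 <= b * log_mgf X s by rewrite mulr_ge0.
lra.
Qed.

Lemma chernoff X (s q : R) (A : pred I) : 0 <= s ->
  (forall i, A i -> q <= X i) ->
  \sum_(i | A i) p i <= expR (log_mgf X s - s * q).
Proof.
move=> s0 hA; rewrite expRD lnK ?posrE ?mgf_gt0// /mgf /mean big_distrl/=.
rewrite [leRHS](bigID A)/=; apply: ler_wpDr.
  by apply: sumr_ge0 => i _; rewrite !mulr_ge0// expR_ge0.
apply: ler_sum => i Ai; rewrite -mulrA -expRD ler_peMr// -expR0 ler_expR.
by rewrite -mulrBr mulr_ge0// subr_ge0 hA.
Qed.

End FiniteProbability.

(** * Modified log-Sobolev inequality for sampling without replacement *)

Section SequentialSampling.
Variables (R : realType) (T : finType).
Implicit Types (f F : {set T} -> R) (S : {set T}) (k : nat).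

(** The conditional expectation of [f] at the final sample when [S] is already drawn and [k] points
    are still to come. The recursion on the first draw is the one the entropy chain rule follows. *)
Fixpoint sampling k f S : R :=
  if k is k'.+1 then #|~: S|%:R^-1 * \sum_(i in ~: S) sampling k' f (i |: S)
  else f S.

Lemma cardsC_setU1 S i : i \in ~: S -> #|~: (i |: S)|.+1 = #|~: S|.
Proof.
move=> iS; have -> : ~: (i |: S) = ~: S :\ i.
  by apply/setP => j; rewrite !inE negb_or.
by rewrite (cardsD1 i (~: S)) iS.
Qed.

Lemma sampling_gt0 k f S : (forall S', 0 < f S') -> (k <= #|~: S|)%N ->
  0 < sampling k f S.
Proof.
move=> f0; elim: k S => [|k IH] S //= kS.
have S0 : (0 < #|~: S|)%N by exact: leq_ltn_trans kS.
rewrite mulr_gt0 ?invr_gt0 ?ltr0n//.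
have [j jS] := card_gt0P S0.
rewrite (bigD1 j)//= ltr_pwDl//.
  by apply: IH; rewrite -ltnS cardsC_setU1.
by apply: sumr_ge0 => i /andP[iS _]; apply/ltW/IH; rewrite -ltnS cardsC_setU1.
Qed.

(** Splits off the last draw instead of the first, which is what identifies sequential draws with a
    uniform subset in [sampling_mean]. *)
Lemma sampling_recr k f S : sampling k.+1 f S = sampling k (sampling 1 f) S.
Proof.
elim: k S => [//|k IH] S.
by rewrite [LHS]/=; congr (_ * _); apply: eq_bigr => i _; exact: IH.
Qed.

(** The Dirichlet form of one draw: [i] and [j] are independent and uniform outside [S], so the two
    sets differ by at most one swap. *)
Definition energy f S : R := #|~: S|%:R^-1 ^+ 2 *
  \sum_(i in ~: S) \sum_(j in ~: S) log_diff (f (i |: S)) (f (j |: S)).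

(* Draws from [i |: S] and [j |: S] are coupled by drawing the same point, or
   by drawing [j] and [i] respectively. *)
Lemma log_diff_sampling F S i j :
  (forall l, l \in ~: S -> forall i, i \in ~: (l |: S) -> 0 < F (i |: (l |: S))) ->
  i \in ~: S -> j \in ~: S ->
  log_diff (sampling 1 F (i |: S)) (sampling 1 F (j |: S))
  <= (#|~: S|.-1)%:R^-1 * \sum_(l in ~: S)
       (if (i \in ~: (l |: S)) && (j \in ~: (l |: S))
        then log_diff (F (i |: (l |: S))) (F (j |: (l |: S))) else 0).
Proof.
move=> F0 iS jS; have [<-{j jS}|ij] := eqVneq i j.
  rewrite log_diffxx big1 ?mulr0// => l _.
  by rewrite log_diffxx if_same.
have split_sum (a b : T) : a \in ~: S -> b \in ~: S -> a != b ->
    \sum_(l in ~: (a |: S)) F (l |: (a |: S))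
    = F (a |: (b |: S)) + \sum_(l in ~: S | (a \in ~: (l |: S)) && (b \in ~: (l |: S)))
                              F (a |: (l |: S)).
  move=> aS bS ab; rewrite (bigD1 b)/=; last first.
    by move: bS; rewrite !inE negb_or eq_sym ab.
  rewrite finset.setUCA; congr (_ + _); apply: eq_big => [l|l _]; last by rewrite finset.setUCA.
  move: aS bS; rewrite !inE !negb_or => -> ->.
  by rewrite !andbT (eq_sym a) (eq_sym b); case: (l == a); case: (l == b); case: (l \in S).
have M2 : (1 < #|~: S|)%N.
  by rewrite (cardsD1 i) iS (cardsD1 j) in_setD1 jS eq_sym ij.
have c0 : 0 < (#|~: S|.-1)%:R^-1 :> R by rewrite invr_gt0 ltr0n -subn1 subn_gt0.
rewrite /=.
have ei : #|~: (i |: S)| = #|~: S|.-1 by rewrite -(cardsC_setU1 iS).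
have ej : #|~: (j |: S)| = #|~: S|.-1 by rewrite -(cardsC_setU1 jS).
rewrite ei ej (split_sum i j)// (split_sum j i) 1?eq_sym//.
have -> : F (j |: (i |: S)) = F (i |: (j |: S)) by rewrite finset.setUCA.
have -> : \sum_(l in ~: S | (j \in ~: (l |: S)) && (i \in ~: (l |: S)))
    F (j |: (l |: S))
  = \sum_(l in ~: S | (i \in ~: (l |: S)) && (j \in ~: (l |: S)))
    F (j |: (l |: S)).
  by apply: eq_bigl => l; rewrite [(j \in _) && _]andbC.
have Fc : 0 < F (i |: (j |: S)).
  by apply: F0 => //; move: iS; rewrite !inE negb_or ij.
rewrite -big_mkcondr/=.
have Fi l : (l \in ~: S) && ((i \in ~: (l |: S)) && (j \in ~: (l |: S))) ->
    0 < F (i |: (l |: S)) by move=> /and3P[? ? _]; exact: F0.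
have Fj l : (l \in ~: S) && ((i \in ~: (l |: S)) && (j \in ~: (l |: S))) ->
    0 < F (j |: (l |: S)) by move=> /and3P[? _ ?]; exact: F0.
have pos (G : T -> R) : (forall l, (l \in ~: S) &&
    ((i \in ~: (l |: S)) && (j \in ~: (l |: S))) -> 0 < G l) ->
    0 < F (i |: (j |: S)) + \sum_(l in ~: S |
      (i \in ~: (l |: S)) && (j \in ~: (l |: S))) G l.
  by move=> G0; rewrite ltr_pwDl// sumr_ge0// => l /G0/ltW.
rewrite log_diff_homo//; [|exact: pos|exact: pos].
by rewrite ler_pM2l// log_diff_sum.
Qed.

(** Sum the coupling bound over the common draw [l] first: this gives the energies at [l |: S], with
    a spare factor [(M - 1) / M <= 1]. *)
Lemma energy_sampling1 k f S : (forall S', 0 < f S') -> (k.+1 < #|~: S|)%N ->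
  energy (sampling k.+1 f) S <= sampling 1 (energy (sampling k f)) S.
Proof.
move=> f0 kS.
set F := sampling k f.
have F0 l : l \in ~: S -> forall i, i \in ~: (l |: S) -> 0 < F (i |: (l |: S)).
  move=> lS i ilS; apply: sampling_gt0 => //.
  have := cardsC_setU1 lS; have := cardsC_setU1 ilS; lia.
have M1 : (1 < #|~: S|)%N by exact: leq_ltn_trans kS.
have M0 : (0 < #|~: S|%:R :> R) by rewrite ltr0n ltnW.
set M := #|~: S| in M0 *.
pose G l i j := if (i \in ~: (l |: S)) && (j \in ~: (l |: S))
        then log_diff (F (i |: (l |: S))) (F (j |: (l |: S))) else 0.
have step : energy (sampling k.+1 f) S <= M%:R^-1 ^+ 2 *
    \sum_(i in ~: S) \sum_(j in ~: S) (M.-1)%:R^-1 * \sum_(l in ~: S) G l i j.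
  rewrite ler_pM2l ?exprn_gt0 ?invr_gt0//.
  apply: ler_sum => i iS; apply: ler_sum => j jS.
  exact: log_diff_sampling.
apply: le_trans step _.
have -> : \sum_(i in ~: S) \sum_(j in ~: S) (M.-1)%:R^-1 * \sum_(l in ~: S) G l i j
  = (M.-1)%:R^-1 * \sum_(l in ~: S) \sum_(i in ~: S) \sum_(j in ~: S) G l i j.
  rewrite big_distrr/= [RHS](eq_bigr (fun l =>
    \sum_(i in ~: S) \sum_(j in ~: S) (M.-1)%:R^-1 * G l i j)); last first.
    by move=> l _; rewrite big_distrr/=; apply: eq_bigr => i _; rewrite big_distrr.
  rewrite [RHS]exchange_big/=; apply: eq_bigr => i _.
  by rewrite [RHS]exchange_big/=; apply: eq_bigr => j _; rewrite big_distrr.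
have -> : \sum_(l in ~: S) \sum_(i in ~: S) \sum_(j in ~: S) G l i j
   = (M.-1)%:R ^+ 2 * \sum_(l in ~: S) energy F (l |: S).
  rewrite big_distrr/=; apply: eq_bigr => l lS.
  have sub i : (i \in ~: (l |: S)) -> i \in ~: S.
    by rewrite !inE negb_or => /andP[].
  rewrite /energy (_ : #|~: (l |: S)| = M.-1); last by rewrite /M -(cardsC_setU1 lS).
  rewrite exprVn mulVKf ?expf_neq0 ?pnatr_eq0 -?lt0n -?subn1 ?subn_gt0//.
  rewrite big_mkcond [RHS]big_mkcond/=; apply: eq_bigr => i _.
  rewrite /G; case: ifPn => [iS|iS]; last first.
    by case: ifPn => // /sub; rewrite (negbTE iS).
  case: ifPn => [ilS|ilS]; last by rewrite big1.
  rewrite big_mkcond [RHS]big_mkcond/=; apply: eq_bigr => j _.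
  by case: ifPn => [jS|jS] //; case: ifPn => // /sub; rewrite (negbTE jS).
rewrite [leRHS]/= -/M.
set X := \sum_(l in ~: S) energy F (l |: S).
have X0 : 0 <= X.
  apply: sumr_ge0 => l lS; rewrite mulr_ge0// ?exprn_ge0//.
  apply: sumr_ge0 => i iS; apply: sumr_ge0 => j jS.
  exact: log_diff_ge0 (F0 _ lS _ iS) (F0 _ lS _ jS).
have [m Em] : exists m, M = m.+2 by exists (M - 2)%N; lia.
have m1 : 0 < m.+1%:R :> R by rewrite ltr0n.
have m2 : 0 < m.+2%:R :> R by rewrite ltr0n.
rewrite Em /= !mulrA ler_wpM2r//.
have -> : m.+2%:R^-1 ^+ 2 * m.+1%:R^-1 * m.+1%:R * m.+1%:R
   = m.+2%:R^-1 * (m.+1%:R / m.+2%:R) :> R by field; rewrite !gt_eqF.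
apply: ler_piMr; first by rewrite invr_ge0 ltW.
by rewrite ler_pdivrMr// mul1r ler_nat.
Qed.

Lemma energy_sampling k f S : (forall S', 0 < f S') -> (k < #|~: S|)%N ->
  energy (sampling k f) S <= sampling k (energy f) S.
Proof.
move=> f0; elim: k S => [//|k IH] S kS.
apply: le_trans (energy_sampling1 f0 kS) _.
rewrite [leRHS]/=; apply: ler_wpM2l; rewrite ?invr_ge0//.
apply: ler_sum => i iS; apply: IH.
by rewrite -ltnS cardsC_setU1.
Qed.

(** Half the mean of [log_diff] is the covariance of [F] and [ln F]; Jensen's inequality for [ln]
    compares it with the entropy. *)
Lemma entropy_le_log_diff (A : {set T}) (F : T -> R) :
  (0 < #|A|)%N -> (forall i, i \in A -> 0 < F i) ->
  #|A|%:R^-1 * \sum_(i in A) F i * ln (F i)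
  - (#|A|%:R^-1 * \sum_(i in A) F i) * ln (#|A|%:R^-1 * \sum_(i in A) F i)
  <= 1 / 2 * (#|A|%:R^-1 ^+ 2 * \sum_(i in A) \sum_(j in A) log_diff (F i) (F j)).
Proof.
move=> A0 F0; set M : R := #|A|%:R; have M0 : 0 < M by rewrite ltr0n.
set SF := \sum_(i in A) F i; set SL := \sum_(i in A) ln (F i).
set SFL := \sum_(i in A) F i * ln (F i).
have SF0 : 0 < SF.
  have [j jA] := card_gt0P A0; rewrite /SF (bigD1 j)//= ltr_pwDl ?F0//.
  by apply: sumr_ge0 => i /andP[/F0/ltW].
have a0 : 0 < M^-1 * SF by rewrite mulr_gt0 ?invr_gt0.
set a := M^-1 * SF in a0 *.
have jensen : SL <= M * ln a.
  have : \sum_(i in A) (ln (F i) - ln a) <= \sum_(i in A) (F i / a - 1).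
    apply: ler_sum => i iA; rewrite -ln_div ?posrE ?F0//.
    by apply: ln_le_subr1; rewrite divr_gt0 ?F0.
  rewrite !sumrB !sumr_const -big_distrl/= -/SL -/SF -(mulr_natl (ln a)) -/M.
  have -> : SF / a = M by rewrite /a; field; rewrite !gt_eqF.
  lra.
have -> : \sum_(i in A) \sum_(j in A) log_diff (F i) (F j)
   = 2 * (M * SFL - SF * SL).
  transitivity (\sum_(i in A) ((M * (F i * ln (F i)) - F i * SL)
                                - (ln (F i) * SF - SFL))).
    apply: eq_bigr => i _.
    rewrite /M mulr_natl -sumr_const /SL /SF /SFL !big_distrr/= -!sumrB.
    by apply: eq_bigr => j _; rewrite /log_diff; ring.
  rewrite !sumrB sumr_const -(mulr_natl SFL) -big_distrr/= -/SFL -!big_distrl/= -/SF -/SL -/M.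
  ring.
have -> : 1 / 2 * (M^-1 ^+ 2 * (2 * (M * SFL - SF * SL))) = M^-1 * SFL - a * (M^-1 * SL).
  by rewrite /a; field; rewrite gt_eqF.
rewrite lerD2l lerN2; apply: ler_wpM2l; first exact: ltW.
by rewrite mulrC ler_pdivrMr// mulrC.
Qed.

(** Chain rule by induction: the entropies conditional on the first draw give [(k+1)/2], and the
    entropy of the conditional mean adds [1/2] after [energy_sampling]. Only [k] draws precede
    [energy], which makes the last draw itself. *)
Lemma entropy_sampling k f S : (forall S', 0 < f S') -> (k < #|~: S|)%N ->
  sampling k.+1 (fun S' => f S' * ln (f S')) S
    - sampling k.+1 f S * ln (sampling k.+1 f S)
  <= k.+1%:R / 2 * sampling k (energy f) S.
Proof.
move=> f0; elim: k S => [|k IH] S kS.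
  exact: (@entropy_le_log_diff (~: S) (fun i => f (i |: S))).
have M0 : (0 < #|~: S|)%N by exact: leq_ltn_trans kS.
set F := sampling k.+1 f; set fl := fun S' => f S' * ln (f S').
have F0 i : i \in ~: S -> 0 < F (i |: S).
  by move=> iS; apply: sampling_gt0 => //; have := cardsC_setU1 iS; lia.
have h1 : #|~: S|%:R^-1 * \sum_(i in ~: S) (sampling k.+1 fl (i |: S)
       - F (i |: S) * ln (F (i |: S))) <=
   k.+1%:R / 2 * sampling k.+1 (energy f) S.
  rewrite [sampling k.+1 (energy f) S]/= mulrCA ler_wpM2l ?invr_ge0// big_distrr/=.
  apply: ler_sum => i iS; apply: IH.
  by have := cardsC_setU1 iS; lia.
have h2 := entropy_le_log_diff M0 F0.
have h3 : energy F S <= sampling k.+1 (energy f) S by exact: energy_sampling.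
have -> : sampling k.+2 f S = #|~: S|%:R^-1 * \sum_(i in ~: S) F (i |: S) by [].
have -> : sampling k.+2 fl S
   = #|~: S|%:R^-1 * \sum_(i in ~: S) sampling k.+1 fl (i |: S) by [].
rewrite -[k.+2]addn1 natrD.
move: h1; rewrite sumrB mulrBr; move: h2; rewrite -/(energy F S).
lra.
Qed.

End SequentialSampling.

(** * Uniform subsets of fixed size and the swap walk *)

Section UniformSubsets.
Variables (R : realType) (n : nat).
Implicit Types (f g V : {set 'I_n} -> R) (S Z : {set 'I_n}) (u m k : nat).

(** Double counting of sets with a marked point, by the bijection [(S, i) -> (i |: S, i)] with
    inverse [(Z, i) -> (Z :\ i, i)]. *)
Lemma sum_setU1_setD1 k (F : {set 'I_n} -> 'I_n -> R) :
  \sum_(S : {set 'I_n} | #|S| == k) \sum_(i in ~: S) F (i |: S) i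
  = \sum_(Z : {set 'I_n} | #|Z| == k.+1) \sum_(i in Z) F Z i.
Proof.
rewrite pair_big_dep [RHS]pair_big_dep/=.
rewrite [RHS](reindex_onto (fun p => (p.2 |: p.1, p.2))
                           (fun p => (p.1 :\ p.2, p.2)))/=; last first.
  by move=> [Z i]/= /andP[_ iZ]; rewrite finset.setD1K.
apply: eq_bigl => -[S i]/=; rewrite finset.setU11 andbT xpair_eqE eqxx andbT.
rewrite cardsU1 inE; case: (boolP (i \in S)) => iS /=.
  rewrite andbF; symmetry; apply/negbTE/negP => /andP[_ /eqP e].
  by move: iS; rewrite -e !inE eqxx.
by rewrite andbT add1n eqSS setU1K ?eqxx ?andbT.
Qed.

Lemma card_slice u : #|[pred Z : {set 'I_n} | #|Z| == u]| = 'C(n, u).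
Proof.
by rewrite -[in RHS](card_ord n) -card_draws -cardsE; apply: eq_card => Z; rewrite !inE.
Qed.

(** A weight on all subsets, vanishing off size [u], so that the results on finite probability
    spaces apply over the type [{set 'I_n}]. *)
Definition slice u Z : R := (#|Z| == u)%:R / 'C(n, u)%:R.

Lemma slice_ge0 u Z : 0 <= slice u Z.
Proof. by rewrite divr_ge0. Qed.

Lemma mean_slice u f :
  mean (slice u) f = 'C(n, u)%:R^-1 * \sum_(Z : {set 'I_n} | #|Z| == u) f Z.
Proof.
rewrite /mean big_distrr/= [RHS]big_mkcond/=; apply: eq_bigr => Z _.
by rewrite /slice; case: ifP => _; rewrite ?mul1r ?mul0r.
Qed.

Lemma Eunif_mean u f : Eunif u f = mean (slice u) f.
Proof. by rewrite mean_slice /Eunif card_slice mulrC. Qed.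

Lemma sum_slice u : (u <= n)%N -> \sum_Z slice u Z = 1.
Proof.
move=> un; have := mean_slice u (fun=> 1).
rewrite /mean; under eq_bigr do rewrite mulr1; move=> ->.
rewrite sumr_const card_slice -[X in _ * X]mulr_natl mulr1 mulVf//.
by rewrite pnatr_eq0 -lt0n bin_gt0.
Qed.

Lemma le_mean_slice u f g : (forall Z, #|Z| = u -> f Z <= g Z) ->
  mean (slice u) f <= mean (slice u) g.
Proof.
move=> fg; rewrite !mean_slice ler_wpM2l ?invr_ge0//.
by apply: ler_sum => Z /eqP /fg.
Qed.

Lemma mean_slice_setU1 k (F : {set 'I_n} -> 'I_n -> R) : (k < n)%N ->
  mean (slice k) (fun S => #|~: S|%:R^-1 * \sum_(i in ~: S) F (i |: S) i)
  = mean (slice k.+1) (fun Z => k.+1%:R^-1 * \sum_(i in Z) F Z i).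
Proof.
move=> kn; rewrite !mean_slice -[in RHS]big_distrr/= -sum_setU1_setD1.
rewrite (eq_bigr (fun S => (n - k)%:R^-1 * \sum_(i in ~: S) F (i |: S) i)); last first.
  by move=> S /eqP cS; rewrite cardsCs finset.setCK card_ord cS.
rewrite -big_distrr/= !mulrA -!invfM -!natrM; congr (_^-1 * _).
by rewrite [in RHS]mulnC mul_bin_left mulnC.
Qed.

Lemma sampling_mean k f : (k <= n)%N -> sampling k f finset.set0 = mean (slice k) f.
Proof.
elim: k f => [|k IH] f kn.
  rewrite mean_slice bin0 invr1 mul1r (big_pred1 finset.set0)// => Z.
  by rewrite cards_eq0.
rewrite sampling_recr IH 1?ltnW//.
have -> := mean_slice_setU1 (fun Z _ => f Z) kn.
rewrite !mean_slice; congr (_ * _); apply: eq_bigr => Z /eqP cZ.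
by rewrite sumr_const cZ -[X in _ * X]mulr_natl mulKf// pnatr_eq0.
Qed.

(* Modified logarithmic Sobolev inequality for the swap walk on [u]-subsets,
   followed by the bound [log_diff_expR_le] on the energy of an exponential. *)
Lemma entropy_slice_left u m g V (s : R) : (u + m = n)%N -> (0 < u)%N ->
  (0 < m)%N -> 0 <= s ->
  (forall Z, #|Z| = u -> \sum_(i in Z) \sum_(j in ~: Z)
     Num.max (g Z - g (j |: Z :\ i)) 0 ^+ 2 <= (u * m)%:R * V Z) ->
  entropy (slice u) (fun Z => expR (s * g Z))
  <= s ^+ 2 * u%:R * mean (slice u) (fun Z => expR (s * g Z) * V Z).
Proof.
case: u => // k kmn _ m0 s0 gV.
have kn : (k < n)%N by lia.
pose f Z := expR (s * g Z); have f0 Z : 0 < f Z by exact: expR_gt0.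
have kc : (k < #|~: (finset.set0 : {set 'I_n})|)%N by rewrite finset.setC0 cardsT card_ord.
have := entropy_sampling f0 kc; rewrite !sampling_mean// 1?ltnW// => h.
apply: le_trans h _.
pose d Z i j := Num.max (g Z - g (j |: Z :\ i)) 0 ^+ 2.
pose F Z i := f Z * \sum_(j in ~: Z) d Z i j.
have energyF S : #|S| = k -> energy f S <= (2 * s ^+ 2 * m.+1%:R^-1) *
    (#|~: S|%:R^-1 * \sum_(i in ~: S) F (i |: S) i).
  move=> cS; have -> : m.+1 = #|~: S|.
    by rewrite cardsCs finset.setCK card_ord cS; lia.
  set M : R := #|~: S|%:R^-1; have M0 : 0 <= M by rewrite invr_ge0.
  have -> : 2 * s ^+ 2 * M * (M * \sum_(i in ~: S) F (i |: S) i)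
     = M ^+ 2 * (2 * s ^+ 2 * \sum_(i in ~: S) F (i |: S) i) by ring.
  rewrite ler_wpM2l ?exprn_ge0//.
  pose A i j := s ^+ 2 * (f (i |: S) * Num.max (g (i |: S) - g (j |: S)) 0 ^+ 2).
  have FA i : i \in ~: S -> s ^+ 2 * F (i |: S) i = \sum_(j in ~: S) A i j.
    move=> iS; rewrite /A -2!big_distrr/=; congr (_ * (_ * _)).
    (* The vanishing term [j = i] is removed, which turns a sum outside [S] into one outside
       [i |: S]. *)
    rewrite [RHS](bigD1 i)//= subrr maxxx expr0n add0r.
    rewrite /d setU1K; last by rewrite !inE in iS.
    by apply: eq_bigl => j; rewrite !inE negb_or andbC.
  have -> : 2 * s ^+ 2 * \sum_(i in ~: S) F (i |: S) i
     = \sum_(i in ~: S) \sum_(j in ~: S) (A i j + A j i).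
    under [RHS]eq_bigr do rewrite big_split/=.
    rewrite big_split/= [X in _ = _ + X]exchange_big/= -mulrA mulr_natl mulr2n big_distrr/=.
    by congr (_ + _); apply: eq_bigr => i /FA.
  apply: ler_sum => i iS; apply: ler_sum => j jS.
  exact: log_diff_expR_le.
rewrite -[in leRHS]mulrA.
apply: (@le_trans _ _ (k.+1%:R / 2 * ((2 * s ^+ 2 * m.+1%:R^-1) *
   mean (slice k.+1) (fun Z => k.+1%:R^-1 * \sum_(i in Z) F Z i)))).
  rewrite ler_wpM2l// -mean_slice_setU1// -meanZ; exact: le_mean_slice.
have -> : forall X : R, k.+1%:R / 2 * (2 * s ^+ 2 * m.+1%:R^-1 * X)
   = s ^+ 2 * (k.+1%:R * (m.+1%:R^-1 * X)).
  by move: (m.+1%:R^-1) => r X; field.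
rewrite ler_wpM2l ?exprn_ge0// ler_wpM2l// -meanZ; apply: le_mean_slice => Z cZ.
rewrite -big_distrr/= -/(f Z) !(mulrCA _ (f Z)); apply: ler_wpM2l; first exact: ltW.
rewrite mulrA -invfM -natrM ler_pdivrMl ?ltr0n//.
have := gV Z cZ; set D := \sum_(i in Z) _ => h.
have D0 : 0 <= D.
  by apply: sumr_ge0 => i _; apply: sumr_ge0 => j _; rewrite exprn_ge0// le_max lexx orbT.
(* Follows from the hypothesis itself; it allows [m] to be raised to [m + 1], the number of points
   outside a [k]-subset. *)
have V0 : 0 <= V Z.
  by have := le_trans D0 h; rewrite pmulr_rge0// ltr0n muln_gt0.
by apply: le_trans h _; rewrite ler_wpM2r// ler_nat mulnC leq_mul.
Qed.

Lemma mean_slice_setC u m f : (u + m = n)%N ->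
  mean (slice m) (fun Z => f (~: Z)) = mean (slice u) f.
Proof.
move=> umn; rewrite !mean_slice -bin_sub; last by rewrite -umn leq_addl.
have -> : (n - m)%N = u by lia.
congr (_ * _); rewrite [RHS](reindex_inj (@finset.setC_inj _))/=.
apply: eq_bigl => Z; have := cardsC Z; rewrite card_ord => h.
apply/eqP/eqP => e.
  by apply: (@addnI m); rewrite -{1}e h addnC umn.
by apply: (@addIn u); rewrite -{1}e h addnC umn.
Qed.

(** Complementation carries swaps of [u]-subsets to swaps of [m]-subsets, so the smaller of the two
    sizes can be taken. *)
Lemma entropy_slice u m g V (s : R) : (u + m = n)%N -> (0 < u)%N ->
  (0 < m)%N -> 0 <= s ->
  (forall Z, #|Z| = u -> \sum_(i in Z) \sum_(j in ~: Z)
     Num.max (g Z - g (j |: Z :\ i)) 0 ^+ 2 <= (u * m)%:R * V Z) ->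
  entropy (slice u) (fun Z => expR (s * g Z))
  <= s ^+ 2 * (minn u m)%:R * mean (slice u) (fun Z => expR (s * g Z) * V Z).
Proof.
move=> umn u0 m0 s0 gV; have [um|/ltnW mu] := leqP u m.
  by exact: entropy_slice_left umn u0 m0 s0 gV.
rewrite /entropy -!(mean_slice_setC _ umn).
apply: (@entropy_slice_left m u (fun Z => g (~: Z)) (fun Z => V (~: Z))) => //.
  by rewrite addnC.
move=> Z cZ; have cZ' : #|~: Z| = u.
  apply: (@addnI m); rewrite [RHS]addnC umn -{1}cZ.
  by have := cardsC Z; rewrite card_ord.
rewrite mulnC; apply: le_trans (gV _ cZ').
rewrite exchange_big/= finset.setCK le_eqVlt; apply/orP; left; apply/eqP.
apply: eq_bigr => j jZ; apply: eq_bigr => i iZ; congr (Num.max (_ - g _) 0 ^+ 2).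
apply/setP => l; move: jZ iZ; rewrite !inE => jZ iZ.
have ij : i != j by apply: contraNneq jZ => <-.
have [->|li] := eqVneq l i; first by rewrite iZ (negbTE ij).
by have [->|lj] := eqVneq l j; rewrite ?(negbTE jZ) ?negb_or.
Qed.

End UniformSubsets.
Arguments slice {R n} u Z.

(** * Concentration of suprema of train-test gaps *)

Section SupremumConcentration.
Variables (R : realType) (u m : nat).
Hypotheses (u_gt0 : (0 < u)%N) (m_gt0 : (0 < m)%N).
Let n := (u + m)%N.
Let N : R := (minn u m)%:R.
Implicit Types (Z : {set 'I_n}) (h : 'I_n -> R).

Lemma avg_setU1D1 h Z i j : i \in Z -> j \in ~: Z ->
  avg h (j |: Z :\ i) = avg h Z + #|Z|%:R^-1 * (h j - h i).
Proof.
move=> iZ jZ; have jZi : j \notin Z :\ i.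
  by move: jZ; rewrite !inE => /negbTE ->; rewrite andbF.
rewrite /avg cardsU1 jZi add1n.
rewrite (big_setU1 _ jZi)/= -mulrDr [in RHS](big_setD1 i iZ)/=.
have -> : #|Z :\ i|.+1 = #|Z| by rewrite [RHS](cardsD1 i) iZ.
by congr (_ * _); ring.
Qed.

Lemma setC_setU1D1 Z i j : i \in Z -> j \in ~: Z ->
  ~: (j |: Z :\ i) = i |: (~: Z) :\ j.
Proof.
move=> iZ jZ; apply/setP => l; move: jZ; rewrite !inE => jZ.
have ij : i != j by apply: contraNneq jZ => <-.
have [->|li] := eqVneq l i; first by rewrite (negbTE ij).
by have [->|lj] := eqVneq l j; rewrite ?(negbTE jZ) ?negb_or.
Qed.

Lemma card_setC_slice Z : #|Z| = u -> #|~: Z| = m.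
Proof.
move=> cZ; apply: (@addnI u); rewrite -{1}cZ.
by have := cardsC Z; rewrite card_ord.
Qed.

Variables (J : finType) (phi : J -> 'I_n -> R).

Definition sq_avg j Z : R :=
  avg (fun i => phi j i ^+ 2) Z + avg (fun i => phi j i ^+ 2) (~: Z).

(** The base value 0 makes the supremum nonnegative, as [herbst] requires. *)
Definition max0 (psi : J -> {set 'I_n} -> R) Z : R :=
  \big[Num.max/0]_j psi j Z.

Lemma max0_ge0 psi Z : 0 <= max0 psi Z.
Proof. exact: bigmax_ge_id. Qed.

Lemma max0_ge psi j Z : psi j Z <= max0 psi Z.
Proof. exact: le_bigmax. Qed.

Lemma max0_attained psi Z : max0 psi Z = 0 \/ exists j, max0 psi Z = psi j Z.
Proof.
rewrite /max0; elim/big_ind: _ => [|x y hx hy|j _]; [by left| |by right; exists j].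
by rewrite /Num.max; case: ifP.
Qed.

(** A decrease of the supremum is at most the decrease of its maximizer [t] at [Z], which does not
    depend on the swap. Summing [phi t i ^+ 2 + phi t j ^+ 2] over all swaps gives [u m] times
    [sq_avg t Z]. *)
Lemma sum_swap_max0 (psi : J -> {set 'I_n} -> R) (C : R) : 0 <= C ->
  (forall Z i j t, #|Z| = u -> i \in Z -> j \in ~: Z ->
    (psi t Z - psi t (j |: Z :\ i)) ^+ 2
    <= C * (phi t i ^+ 2 + phi t j ^+ 2)) ->
  forall Z, #|Z| = u -> \sum_(i in Z) \sum_(j in ~: Z)
     Num.max (max0 psi Z - max0 psi (j |: Z :\ i)) 0 ^+ 2
  <= (u * m)%:R * (C * max0 sq_avg Z).
Proof.
move=> C0 hC Z cZ; have cZ' := card_setC_slice cZ.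
have [g0|[t gt]] := max0_attained psi Z.
  rewrite big1 ?mulr_ge0 ?max0_ge0// => i _; rewrite big1// => j _.
  by rewrite (max_idPr _) ?expr0n// g0 sub0r oppr_le0 max0_ge0.
apply: (@le_trans _ _ (\sum_(i in Z) \sum_(j in ~: Z)
    C * (phi t i ^+ 2 + phi t j ^+ 2))).
  apply: ler_sum => i iZ; apply: ler_sum => j jZ.
  apply: le_trans (hC Z i j t cZ iZ jZ); rewrite gt.
  have [le0|gt0] := leP (psi t Z - max0 psi (j |: Z :\ i)) 0.
    by rewrite expr0n sqr_ge0.
  have : psi t Z - max0 psi (j |: Z :\ i) <= psi t Z - psi t (j |: Z :\ i).
    by rewrite lerD2l lerN2 max0_ge.
  move=> le1; rewrite lerXn2r// nnegrE ?ltW//.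
  exact: lt_le_trans le1.
have -> : \sum_(i in Z) \sum_(j in ~: Z) C * (phi t i ^+ 2 + phi t j ^+ 2)
   = (u * m)%:R * (C * sq_avg t Z).
  under eq_bigr do rewrite -big_distrr/= big_split/= sumr_const cZ'.
  rewrite -big_distrr/= big_split/= sumr_const cZ sumrMnl.
  rewrite /sq_avg /avg cZ cZ' natrM -[X in X + _]mulr_natl -[X in _ + X]mulr_natl.
  by field; rewrite !pnatr_eq0 -!lt0n u_gt0 m_gt0.
by rewrite ler_wpM2l// ler_wpM2l// max0_ge.
Qed.

Let N_gt0 : 0 < N.
Proof. by rewrite ltr0n leq_min u_gt0. Qed.

Let invu_le : u%:R^-1 <= N^-1.
Proof.
have h : N <= u%:R by rewrite ler_nat geq_minl.
by rewrite lef_pV2// posrE ltr0n.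
Qed.

Let invm_le : m%:R^-1 <= N^-1.
Proof.
have h : N <= m%:R by rewrite ler_nat geq_minr.
by rewrite lef_pV2// posrE ltr0n.
Qed.

Definition gap j Z : R := avg (phi j) Z - avg (phi j) (~: Z).

(** A swap moves a gap by [(1/u + 1/m) (a - b)], whose square is at most [(2/N)^2 * 2 (a^2 + b^2)];
    [entropy_slice] contributes a factor [N]. *)
Lemma entropy_gap (s : R) : 0 <= s ->
  entropy (slice u) (fun Z => expR (s * max0 gap Z))
  <= s ^+ 2 * (8 / N) *
     mean (slice u) (fun Z => expR (s * max0 gap Z) * max0 sq_avg Z).
Proof.
move=> s0; have C0 : 0 <= 8 / N ^+ 2 by rewrite divr_ge0 ?sqr_ge0.
have hC Z i j t : #|Z| = u -> i \in Z -> j \in ~: Z ->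
    (gap t Z - gap t (j |: Z :\ i)) ^+ 2
    <= (8 / N ^+ 2) * (phi t i ^+ 2 + phi t j ^+ 2).
  move=> cZ iZ jZ; rewrite /gap setC_setU1D1// !avg_setU1D1// ?inE ?negbK//.
  rewrite cZ card_setC_slice//.
  set a := phi t i; set b := phi t j.
  have -> : avg (phi t) Z - avg (phi t) (~: Z) - (avg (phi t) Z
     + u%:R^-1 * (b - a) - (avg (phi t) (~: Z) + m%:R^-1 * (a - b)))
     = (u%:R^-1 + m%:R^-1) * (a - b) by ring.
  rewrite exprMn; apply: (@le_trans _ _ ((2 * N^-1) ^+ 2 * (2 * (a ^+ 2 + b ^+ 2)))).
    apply: ler_pM; rewrite ?sqr_ge0//; last by have := sqr_ge0 (a + b); lra.
    have i0 : 0 <= 2 / N by rewrite divr_ge0// ltW.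
    rewrite lerXn2r ?nnegrE ?addr_ge0 ?invr_ge0//.
    by have := lerD invu_le invm_le; lra.
  rewrite le_eqVlt; apply/orP; left; apply/eqP.
  by field; rewrite gt_eqF.
have := entropy_slice (erefl n) u_gt0 m_gt0 s0 (sum_swap_max0 C0 hC).
rewrite (_ : (fun Z => expR (s * max0 gap Z) * (8 / N ^+ 2 * max0 sq_avg Z))
  = (fun Z => 8 / N ^+ 2 * (expR (s * max0 gap Z) * max0 sq_avg Z))).
  rewrite meanZ mulrA -/N => /le_trans; apply.
  rewrite le_eqVlt; apply/orP; left; apply/eqP; congr (_ * _).
  by field; rewrite gt_eqF.
by apply/funext => Z; ring.
Qed.

Variable H0 : R.
Hypotheses (H0_gt0 : 0 < H0) (phi_le : forall j i, `|phi j i| <= H0).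

(** Self-bounding: the two averages move in opposite directions, so a swap costs
    [|1/u - 1/m| <= 1/N] times [|a - b|], and [(a - b)^2 <= max(a, b) (a + b)] for squares [a], [b]
    bounded by [H0^2]. *)
Lemma entropy_sq_avg (s : R) : 0 <= s ->
  entropy (slice u) (fun Z => expR (s * max0 sq_avg Z))
  <= s ^+ 2 * (H0 ^+ 2 / N) *
     mean (slice u) (fun Z => max0 sq_avg Z * expR (s * max0 sq_avg Z)).
Proof.
move=> s0; have C0 : 0 <= H0 ^+ 2 / N ^+ 2 by rewrite divr_ge0 ?sqr_ge0.
have hC Z i j t : #|Z| = u -> i \in Z -> j \in ~: Z ->
    (sq_avg t Z - sq_avg t (j |: Z :\ i)) ^+ 2
    <= (H0 ^+ 2 / N ^+ 2) * (phi t i ^+ 2 + phi t j ^+ 2).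
  move=> cZ iZ jZ; rewrite /sq_avg setC_setU1D1// !avg_setU1D1// ?inE ?negbK//.
  rewrite cZ card_setC_slice//.
  set A := avg _ Z; set B := avg _ (~: Z).
  have bd l : 0 <= phi t l ^+ 2 <= H0 ^+ 2.
    rewrite sqr_ge0/= -[phi t l ^+ 2]real_normK ?num_real//.
    by rewrite lerXn2r ?nnegrE// ltW.
  set a := phi t i ^+ 2; set b := phi t j ^+ 2.
  have /andP[a0 aH] := bd i; have /andP[b0 bH] := bd j.
  rewrite -/a in a0 aH; rewrite -/b in b0 bH.
  have -> : A + B - (A + u%:R^-1 * (b - a) + (B + m%:R^-1 * (a - b)))
     = (u%:R^-1 - m%:R^-1) * (a - b) by ring.
  have -> : H0 ^+ 2 / N ^+ 2 * (a + b) = N ^- 2 * (H0 ^+ 2 * (a + b)) by ring.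
  rewrite exprMn; apply: ler_pM; rewrite ?sqr_ge0//.
    rewrite -exprVn -[leLHS]real_normK ?num_real// lerXn2r ?nnegrE ?invr_ge0 ?(ltW N_gt0)//.
    have iu : 0 <= u%:R^-1 :> R by rewrite invr_ge0.
    have im : 0 <= m%:R^-1 :> R by rewrite invr_ge0.
    by rewrite ler_norml; have := invu_le; have := invm_le; lra.
  apply: (@le_trans _ _ (Num.max a b * (a + b))).
    have [ab|ab] := leP a b.
      by rewrite -subr_ge0 (_ : _ - _ = a * (b - a) + 2 * (a * b)); [nra|ring].
    by rewrite -subr_ge0 (_ : _ - _ = b * (a - b) + 2 * (a * b)); [nra|ring].
  by rewrite ler_wpM2r ?addr_ge0// ge_max aH.
have := entropy_slice (erefl n) u_gt0 m_gt0 s0 (sum_swap_max0 C0 hC).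
rewrite (_ : (fun Z => expR (s * max0 sq_avg Z) * (H0 ^+ 2 / N ^+ 2 * max0 sq_avg Z))
  = (fun Z => H0 ^+ 2 / N ^+ 2 * (max0 sq_avg Z * expR (s * max0 sq_avg Z)))).
  rewrite meanZ mulrA -/N => /le_trans; apply.
  rewrite le_eqVlt; apply/orP; left; apply/eqP; congr (_ * _).
  by field; rewrite gt_eqF.
by apply/funext => Z; ring.
Qed.

Let slice1 : \sum_(Z : {set 'I_n}) slice u Z = 1 :> R.
Proof. by apply: sum_slice; exact: leq_addr. Qed.

(** The choice of [s] makes [H0^2 / N = 1 / (4 s)], so Herbst's bound reads [L <= s E + L / 4]. *)
Lemma log_mgf_sq_avg (s := N / (4 * H0 ^+ 2)) :
  log_mgf (slice u) (max0 sq_avg) s <= s * (4 / 3 * mean (slice u) (max0 sq_avg)).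
Proof.
have HN : 0 < 4 * H0 ^+ 2 by rewrite mulr_gt0// exprn_gt0.
have s0 : 0 < s by rewrite divr_gt0.
have b0 : 0 <= H0 ^+ 2 / N by rewrite divr_ge0 ?sqr_ge0 ?ltW.
have ent (t : R) : 0 < t <= s ->
    entropy (slice u) (fun Z => expR (t * max0 sq_avg Z))
    <= t ^+ 2 * (0 * mgf (slice u) (max0 sq_avg) t + H0 ^+ 2 / N *
         mean (slice u) (fun Z => max0 sq_avg Z * expR (t * max0 sq_avg Z))).
  by move=> /andP[t0 _]; rewrite mul0r add0r mulrA; exact: entropy_sq_avg (ltW t0).
have := herbst (slice_ge0 R u) slice1 (max0_ge0 sq_avg) (lexx 0) b0 s0 ent.
rewrite mul0r addr0; set L := log_mgf _ _ _; set E := mean _ _.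
have -> : H0 ^+ 2 / N = (4 * s)^-1.
  by rewrite /s; field; rewrite !gt_eqF.
rewrite ler_pdivrMr// mulrDl [_ * L * s](_ : _ = L / 4); first lra.
by field; rewrite gt_eqF.
Qed.

Lemma sup_gap_concentration (K q x : R) : 0 < K -> 0 < q -> 0 < x ->
  mean (slice u) (max0 gap) <= q / 4 ->
  mean (slice u) (max0 sq_avg) <= 12 * K * q ->
  (1752 * K + 32 * H0) * x / N <= q ->
  \sum_(Z : {set 'I_n} | q <= max0 gap Z) slice u Z <= expR (- x).
Proof.
move=> K0 q0 x0 Eg EW qx.
(* With [l = N / A], [32 H0^2 l^2 / N^2 <= 1/8] lets the entropy term of the
   duality step be absorbed, and [160 K q l / N <= q / 4]. *)
pose A : R := 876 * K + 16 * H0.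
have H0p := H0_gt0; have A0 : 0 < A by rewrite /A; lra.
pose l := N / A; have l0 : 0 < l by rewrite divr_gt0.
pose s := N / (4 * H0 ^+ 2).
have s0 : 0 < s by rewrite divr_gt0// mulr_gt0// exprn_gt0.
have LW : log_mgf (slice u) (max0 sq_avg) s <= s * (16 * K * q).
  apply: le_trans log_mgf_sq_avg _; rewrite ler_wpM2l ?(ltW s0)//; lra.
have a0 : 0 <= 160 * K * q / N by rewrite divr_ge0 ?mulr_ge0 ?ltW.
have herbst_hyp (t : R) : 0 < t <= l ->
    entropy (slice u) (fun Z => expR (t * max0 gap Z))
    <= t ^+ 2 * (160 * K * q / N * mgf (slice u) (max0 gap) t + 0 *
         mean (slice u) (fun Z => max0 gap Z * expR (t * max0 gap Z))).
  move=> /andP[t0 tl].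
  set f := fun Z => expR (t * max0 gap Z).
  have ent := entropy_gap (ltW t0); rewrite -/f in ent.
  have dual := @entropy_duality _ _ _ (slice_ge0 R u) slice1 f
    (fun Z => s * max0 sq_avg Z) (fun Z => expR_gt0 _).
  rewrite -/(mgf (slice u) (max0 sq_avg) s) -/(log_mgf (slice u) (max0 sq_avg) s) in dual.
  rewrite (_ : (fun Z => f Z * (s * max0 sq_avg Z))
     = (fun Z => s * (f Z * max0 sq_avg Z))) in dual; last first.
    by apply/funext => Z; ring.
  rewrite meanZ in dual.
  have F0 : 0 < mean (slice u) f by exact: mgf_gt0 (slice_ge0 R u) slice1 _ _.
  rewrite mul0r addr0 /mgf -/f.
  move: ent dual F0; set Ent := entropy _ _; set F := mean (slice u) f.
  set P := mean (slice u) _ => ent dual F0.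
  (* The variational formula divided by [s] removes [max0 sq_avg] at the price of a multiple of the
     entropy; [16 = 12 * 4/3]. *)
  have dual2 : P <= Ent / s + F * (16 * K * q).
    rewrite -(ler_pM2l s0); apply: le_trans dual _.
    rewrite mulrDr mulrCA mulfV ?gt_eqF// mulr1 lerD2l mulrCA ler_wpM2l ?(ltW F0)//.
  have c0 : 0 <= t ^+ 2 * (8 / N) by rewrite mulr_ge0 ?sqr_ge0 ?divr_ge0 ?ltW.
  have e2 := le_trans ent (ler_wpM2l c0 dual2).
  (* Bounding the coefficient of [Ent] by [1/8] requires [Ent >= 0]; otherwise the claim is
     immediate. *)
  have [Eneg|Epos] := leP Ent 0.
    apply: le_trans Eneg _; rewrite mulr_ge0 ?sqr_ge0//.
    by rewrite (mulr_ge0 a0)// ltW.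
  have ts : t ^+ 2 * (8 / N) / s <= 1 / 8.
    have -> : t ^+ 2 * (8 / N) / s = 32 * (t * (H0 / N)) ^+ 2.
      by rewrite /s; field; rewrite !gt_eqF.
    have h : t * (H0 / N) <= 1 / 16.
      apply: (@le_trans _ _ (l * (H0 / N))).
        by rewrite ler_wpM2r// divr_ge0// ltW.
      have -> : l * (H0 / N) = H0 / A by rewrite /l; field; rewrite !gt_eqF.
      by rewrite ler_pdivrMr// /A; lra.
    have h0 : 0 <= t * (H0 / N) by rewrite mulr_ge0 ?divr_ge0 ?ltW.
    by nra.
  have e3 : t ^+ 2 * (8 / N) * (Ent / s + F * (16 * K * q))
     <= 1 / 8 * Ent + t ^+ 2 * (128 * K * q / N * F).
    rewrite mulrDr; apply: lerD; last first.
      by rewrite le_eqVlt; apply/orP; left; apply/eqP; ring.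
    by rewrite mulrCA mulrC ler_wpM2r// ?(ltW Epos).
  have e4 := le_trans e2 e3.
  (* Absorbing [Ent / 8] costs a factor [8/7], which is below [160/128 = 5/4]. *)
  have -> : t ^+ 2 * (160 * K * q / N * F)
    = 160 / 128 * (t ^+ 2 * (128 * K * q / N * F)) by field; rewrite gt_eqF.
  by lra.
have := herbst (slice_ge0 R u) slice1 (max0_ge0 gap) a0 (lexx 0) l0 herbst_hyp.
rewrite mul0r addr0 => hL.
have hl : 160 * K * q / N * l <= q / 4.
  have -> : 160 * K * q / N * l = q * (160 * K / A).
    by rewrite /l; field; rewrite !gt_eqF.
  by rewrite ler_pM2l// ler_pdivrMr// /A; lra.
have hL2 : log_mgf (slice u) (max0 gap) l <= (q / 2) * l.
  by rewrite -ler_pdivrMr//; apply: le_trans hL _; lra.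
have h2 Z : q <= max0 gap Z -> q <= max0 gap Z by [].
have := chernoff (slice_ge0 R u) slice1 (ltW l0) h2.
move=> /le_trans; apply.
rewrite ler_expR.
(* Here [A] is half the coefficient of [x / N] in the lower bound on [q]. *)
have : x <= l * q / 2.
  apply: (@le_trans _ _ (l * ((1752 * K + 32 * H0) * x / N) / 2)).
    rewrite le_eqVlt; apply/orP; left; apply/eqP.
    rewrite (_ : 1752 * K + 32 * H0 = 2 * A); last by rewrite /A; ring.
    by rewrite /l; field; rewrite !gt_eqF.
  by rewrite ler_wpM2r// ler_wpM2l// (ltW l0).
lra.
Qed.

End SupremumConcentration.

(** * Peeling *)

Section ClassComplexity.
Variables (R : realType) (n : nat).
Implicit Types (h : 'I_n -> R) (Z : {set 'I_n}) (A : set ('I_n -> R)).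

Lemma avgZ (c : R) h Z : avg (fun i => c * h i) Z = c * avg h Z.
Proof. by rewrite /avg -big_distrr/= mulrCA. Qed.

Lemma norm_avg_le (B : R) h Z : 0 <= B -> (forall i, `|h i| <= B) -> `|avg h Z| <= B.
Proof.
move=> B0 hB; rewrite /avg normrM ger0_norm ?invr_ge0//.
(* Over the empty set [avg] is 0, since the inverse of 0 is 0. *)
have [->|] := eqVneq Z finset.set0; first by rewrite cards0 invr0 mul0r.
rewrite -card_gt0 => Z0; rewrite ler_pdivrMl ?ltr0n//.
apply: le_trans (ler_norm_sum _ _ _) _.
by rewrite mulr_natl -sumr_const; apply: ler_sum.
Qed.

(** The uniform bound [B] makes the set bounded above, so that the real-valued [sup] is a true upper
    bound. *)
Lemma sup_class_ge (B eta : R) A h Z : 0 <= B ->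
  (forall h', A h' -> forall i, `|h' i| <= B) -> A h ->
  eta * (avg h Z - avgn h) <= sup [set eta * (avg h' Z - avgn h') | h' in A].
Proof.
move=> B0 hA Ah; apply: ub_le_sup; last by exists h.
exists (`|eta| * (B + B)) => _ [h' Ah' <-].
apply: le_trans (ler_norm _) _; rewrite normrM ler_wpM2l//.
apply: le_trans (ler_normB _ _) _.
by apply: lerD; apply: norm_avg_le => //; exact: hA.
Qed.

Lemma avg0 Z : avg (fun=> 0 : R) Z = 0.
Proof. by rewrite /avg big1 ?mulr0. Qed.

Lemma sup_class_ge0 (B eta : R) A Z : 0 <= B ->
  (forall h', A h' -> forall i, `|h' i| <= B) -> A (fun=> 0) ->
  0 <= sup [set eta * (avg h' Z - avgn h') | h' in A].
Proof.
move=> B0 hA A0; apply: le_trans (sup_class_ge eta Z B0 hA A0).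
by rewrite /avgn !avg0 subrr mulr0.
Qed.

Lemma avgn_sq h : avgn (fun i => h i ^+ 2) = second_moment h.
Proof.
rewrite /avgn /avg /second_moment cardsT card_ord; congr (_ * _).
by apply: eq_bigl => i; rewrite inE.
Qed.

Lemma PunifE u (E : {set 'I_n} -> Prop) :
  Punif R u E = \sum_(Z : {set 'I_n} | `[< E Z >]) slice u Z.
Proof.
rewrite /Punif card_slice -sum1_card natr_sum big_distrl/=.
rewrite big_mkcondl [RHS]big_mkcond [LHS]big_mkcond/=.
by apply: eq_bigr => Z _; rewrite /slice; do 2!case: ifP => //; rewrite ?mul0r ?mul1r.
Qed.

End ClassComplexity.

Lemma sum_half_le (R : realType) (L : nat) : \sum_(k < L) (1 / 2 : R) ^+ k <= 2.
Proof.
suff -> : \sum_(k < L) (1 / 2 : R) ^+ k = 2 - 2 * (1 / 2) ^+ L.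
  by rewrite gerBl mulr_ge0// exprn_ge0// divr_ge0.
elim: L => [|L IH]; first by rewrite big_ord0 expr0; ring.
by rewrite big_ord_recr/= IH exprS; field.
Qed.

(** The weight [4^-k] beats the growth [2^k] of the level means and leaves a geometric series of
    ratio [1/2]. *)
Lemma mean_peeling_le (R : realType) (I : finType) (p f : I -> R)
    (a : nat -> I -> R) (c s : R) (L : nat) :
  (forall i, 0 <= p i) -> \sum_i p i = 1 -> 0 <= s ->
  (forall i, f i <= c + \sum_(k < L) (1 / 4) ^+ k * a k i) ->
  (forall k, mean p (a k) <= 2 ^+ k * s) ->
  mean p f <= c + 2 * s.
Proof.
move=> p0 p1 s0 fa am; apply: le_trans (le_mean p0 fa) _.
rewrite meanD mean_cst// lerD2l.
have -> : mean p (fun i => \sum_(k < L) (1 / 4) ^+ k * a k i)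
    = \sum_(k < L) (1 / 4) ^+ k * mean p (a k).
  rewrite /mean; under eq_bigr do rewrite big_distrr/=.
  rewrite exchange_big/=; apply: eq_bigr => k _; rewrite big_distrr/=.
  by apply: eq_bigr => i _; rewrite mulrCA.
apply: (@le_trans _ _ (\sum_(k < L) (1 / 2) ^+ k * s)).
  apply: ler_sum => k _.
  have -> : (1 / 2 : R) ^+ k * s = (1 / 4) ^+ k * (2 ^+ k * s).
    by rewrite mulrA -exprMn; congr (_ ^+ _ * _); field.
  by rewrite ler_wpM2l// exprn_ge0// divr_ge0.
by rewrite -big_distrl/= ler_wpM2r// sum_half_le.
Qed.

(** The least admissible [k] works: if [k > 0], level [k - 1] fails. *)
Lemma exists_level (R : realType) (t r : R) : 0 < r ->
  exists k : nat, t <= 4 ^+ k * r /\ (k = 0%N \/ 4 ^+ k * r < 4 * t).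
Proof.
move=> r0; have ex : exists k : nat, t <= 4 ^+ k * r.
  exists (Num.bound (t / r)); rewrite -ler_pdivrMr//.
  apply: le_trans (ltW (upper_nthrootP (leqnn _))) _.
  by rewrite lerXn2r ?nnegrE// ler_nat.
case: (ex_minnP ex) => k tk kmin; exists k; split=> //.
case: k tk kmin => [|k] tk kmin; [by left|right].
rewrite exprS -mulrA ltr_pM2l// ltNge; apply/negP => /kmin.
by rewrite ltnn.
Qed.

(** * Growth of sub-root functions *)

Section SubRoot.
Variables (R : realType) (psi : R -> R) (rs : R).
Hypotheses (psi_sub_root : sub_root psi) (rs_gt0 : 0 < rs) (rs_fixed : psi rs = rs).

Lemma sub_root_pow4 (r : R) (k : nat) : 0 < r -> psi (4 ^+ k * r) <= 2 ^+ k * psi r.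
Proof.
move=> r0; have [_ _ dec] := psi_sub_root.
have k1 : (1 : R) <= 4 ^+ k by rewrite exprn_ege1// ler1n.
have rk : r <= 4 ^+ k * r by rewrite ler_peMl// ltW.
have s0 : 0 < Num.sqrt r by rewrite sqrtr_gt0.
have k0 : 0 < 2 ^+ k :> R by rewrite exprn_gt0.
have := dec r _ r0 rk.
have -> : Num.sqrt (4 ^+ k * r) = 2 ^+ k * Num.sqrt r.
  rewrite sqrtrM ?exprn_ge0//; congr (_ * _).
  rewrite (_ : 4 ^+ k = (2 ^+ k) ^+ 2 :> R) ?sqrtr_sqr ?ger0_norm ?ltW//.
  by rewrite exprAC; congr (_ ^+ _); ring.
rewrite ler_pdivrMr ?mulr_gt0// => /le_trans; apply.
by rewrite le_eqVlt; apply/orP; left; apply/eqP; field; rewrite gt_eqF.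
Qed.

(** This is [psi r <= sqrt (r rs)], from comparing [psi r / sqrt r] with its value [sqrt rs] at the
    fixed point. *)
Lemma sub_root_sq_le (r : R) : rs <= r -> psi r ^+ 2 <= r * rs.
Proof.
move=> rr; have [pos _ dec] := psi_sub_root.
have r0 : 0 < r by exact: lt_le_trans rr.
have := dec rs r rs_gt0 rr; rewrite rs_fixed.
have s0 : 0 < Num.sqrt r by rewrite sqrtr_gt0.
have -> : rs / Num.sqrt rs = Num.sqrt rs.
  by rewrite -{1}(sqr_sqrtr (ltW rs_gt0)) expr2 mulfK// gt_eqF// sqrtr_gt0.
rewrite ler_pdivrMr// => h.
have p0 : 0 <= psi r by rewrite pos// ltW.
have -> : r * rs = (Num.sqrt rs * Num.sqrt r) ^+ 2.
  by rewrite exprMn !sqr_sqrtr ?ltW// mulrC.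
by apply: lerXn2r; rewrite ?nnegrE ?mulr_ge0 ?sqrtr_ge0.
Qed.

End SubRoot.

Lemma max_complexity_ge (R : realType) (n u : nat) (A B : set ('I_n -> R)) :
  let M := max_complexity u A B in
  [/\ complexity_u u 1 A <= M, complexity_m u (-1) A <= M,
      complexity_u u 1 B <= M & complexity_m u 1 B <= M].
Proof. by rewrite /= /max_complexity !le_max !lexx ?orbT. Qed.

(** * Expectation bounds for the rescaled family *)

Section LocalConcentration.
Variables (R : realType) (u m : nat).
Hypotheses (u_gt0 : (0 < u)%N) (m_gt0 : (0 < m)%N).
Variables (H : set ('I_(u + m) -> R)) (H0 K0 : R) (T : ('I_(u + m) -> R) -> R).
Hypotheses (H_nonempty : H !=set0) (H0_gt0 : 0 < H0)
  (H_bounded : forall h, H h -> forall i, `|h i| <= H0) (K0_gt1 : 1 < K0)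
  (T_ge0 : forall h, H h -> 0 <= T h)
  (T_ge : forall h, H h -> second_moment h <= T h).
Variables (psi : R -> R) (rs : R).
Hypotheses (psi_sub_root : sub_root psi) (rs_gt0 : 0 < rs) (rs_fixed : psi rs = rs)
  (psi_ge : forall r, rs <= r ->
     max_complexity u (sublevel H T r) (sq_sublevel H T r) <= psi r).
Variable q : R.
Hypotheses (q_gt0 : 0 < q) (q_ge : 1152 * K0 * rs <= q).

Let r : R := 4 * K0 * q.

Let K0_gt0 : 0 < K0. Proof. exact: lt_trans K0_gt1. Qed.

Let r_gt0 : 0 < r. Proof. by rewrite !mulr_gt0. Qed.

Let rs_le_r : rs <= r.
Proof.
have h1 : rs <= K0 * rs by rewrite ler_peMl ?ltW.
have h2 : q <= K0 * q by rewrite ler_peMl ?ltW.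
have h3 := rs_gt0; have h4 := q_gt0; have h5 := q_ge; rewrite /r; lra.
Qed.

Let psi_r_ge0 : 0 <= psi r.
Proof. by have [h _ _] := psi_sub_root; rewrite h// ltW. Qed.

(** By [sub_root_sq_le], [psi r ^+ 2 <= 4 K0 q rs], which is at most [(q / 16)^2] once
    [1024 K0 rs <= q]. *)
Let psi_r_le : psi r <= q / 16.
Proof.
have q16 : 0 <= q / 16 by rewrite divr_ge0// ltW.
rewrite -(ler_pXn2r (ltn0Sn 1)) ?nnegrE//.
apply: le_trans (sub_root_sq_le psi_sub_root rs_gt0 rs_fixed rs_le_r) _.
have h1 : q * (1152 * K0 * rs) <= q * q by rewrite ler_pM2l.
have h2 : 0 <= q * q by rewrite mulr_ge0 ?ltW.
rewrite /r expr2; lra.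
Qed.

Let psi_level (k : nat) : psi (4 ^+ k * r) <= 2 ^+ k * psi r.
Proof. exact: sub_root_pow4. Qed.

Let level_ge (k : nat) : rs <= 4 ^+ k * r.
Proof.
apply: le_trans rs_le_r _; apply: ler_peMl; first exact: ltW.
by rewrite exprn_ege1// ler1n.
Qed.

Let dev (A : set ('I_(u + m) -> R)) (eta : R) (Z : {set 'I_(u + m)}) : R :=
  sup [set eta * (avg h Z - avgn h) | h in A].

Let class k := sublevel H T (4 ^+ k * r).
Let sq_class k := sq_sublevel H T (4 ^+ k * r).

Let class_bounded k h : class k h -> forall i, `|h i| <= H0.
Proof. by move=> [[Hh _] i|-> i]; [exact: H_bounded|rewrite normr0 ltW]. Qed.

Let sq_class_bounded k h : sq_class k h -> forall i, `|h i| <= H0 ^+ 2.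
Proof.
move=> [[h' [Hh _] <-] i|-> i]; last by rewrite normr0 sqr_ge0.
by rewrite normrX; apply: lerXn2r; rewrite ?nnegrE ?H_bounded// ltW.
Qed.

(** Centering both averages at [avgn] splits a gap into a positive deviation on [Z] and a negative
    one on its complement; for the sum of averages of squares both signs are positive. *)
Let class_dev k Z := dev (class k) 1 Z + dev (class k) (-1) (~: Z).
Let sq_class_dev k Z := dev (sq_class k) 1 Z + dev (sq_class k) 1 (~: Z).

Let class_dev_ge0 k Z : 0 <= class_dev k Z.
Proof.
have hA : class k (fun=> 0) by right.
by apply: addr_ge0; apply: (sup_class_ge0 _ _ (ltW H0_gt0) (@class_bounded k) hA).
Qed.

Let sq_class_dev_ge0 k Z : 0 <= sq_class_dev k Z.
Proof.
have hA : sq_class k (fun=> 0) by right.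
have B0 : 0 <= H0 ^+ 2 by rewrite sqr_ge0.
by apply: addr_ge0; apply: (sup_class_ge0 _ _ B0 (@sq_class_bounded k) hA).
Qed.

Let mean_class_dev k : mean (slice u) (class_dev k) <= 2 ^+ k * (2 * psi r).
Proof.
rewrite meanD -!Eunif_mean.
have [h1 h2 _ _] := max_complexity_ge u (class k) (sq_class k).
have h3 := psi_ge (level_ge k); have h4 := psi_level k.
have := lerD (le_trans h1 (le_trans h3 h4)) (le_trans h2 (le_trans h3 h4)).
move=> /le_trans; apply; lra.
Qed.

Let mean_sq_class_dev k : mean (slice u) (sq_class_dev k) <= 2 ^+ k * (2 * psi r).
Proof.
rewrite meanD -!Eunif_mean.
have [_ _ h1 h2] := max_complexity_ge u (class k) (sq_class k).
have h3 := psi_ge (level_ge k); have h4 := psi_level k.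
have := lerD (le_trans h1 (le_trans h3 h4)) (le_trans h2 (le_trans h3 h4)).
move=> /le_trans; apply; lra.
Qed.

Variables (J : finType) (f : J -> 'I_(u + m) -> R) (lev : J -> nat).
Hypotheses (fH : forall j, H (f j)) (f_lev : forall j, T (f j) <= 4 ^+ lev j * r).

Let phi j i := (1 / 4) ^+ lev j * f j i.

Let w_ge0 (k : nat) : 0 <= (1 / 4 : R) ^+ k.
Proof. by rewrite exprn_ge0// divr_ge0. Qed.

Let w_le1 (k : nat) : (1 / 4 : R) ^+ k <= 1.
Proof. by rewrite exprn_ile1 ?divr_ge0// ler_pdivrMr// mul1r ler1n. Qed.

Let w_level (k : nat) : (1 / 4 : R) ^+ k * (4 ^+ k * r) = r.
Proof.
have e : 1 / 4 * 4 = 1 :> R by field.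
by rewrite mulrA -exprMn e expr1n mul1r.
Qed.

Let L := (\max_j lev j).+1.

Let level_term_le (a : nat -> R) j : (forall k, 0 <= a k) ->
  (1 / 4) ^+ lev j * a (lev j) <= \sum_(k < L) (1 / 4) ^+ k * a k.
Proof.
move=> a0; have jL : (lev j < L)%N by rewrite ltnS leq_bigmax.
rewrite (bigD1 (Ordinal jL))//= lerDl.
by apply: sumr_ge0 => k _; rewrite mulr_ge0.
Qed.

Lemma weighted_bounded j i : `|phi j i| <= H0.
Proof.
rewrite /phi normrM ger0_norm//.
by apply: le_trans (H_bounded (fH j) i); rewrite ler_piMl.
Qed.

Let sum1 : \sum_(Z : {set 'I_(u + m)}) slice u Z = 1 :> R.
Proof. by apply: sum_slice; exact: leq_addr. Qed.

(** Each function is charged to its own level, the other levels being nonnegative; peeling yields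
    [4 psi r]. *)
Lemma mean_weighted_gap_le : mean (slice u) (max0 (gap phi)) <= q / 4.
Proof.
have h0 : 0 <= 2 * psi r by rewrite mulr_ge0.
have fa Z : max0 (gap phi) Z <= 0 + \sum_(k < L) (1 / 4) ^+ k * class_dev k Z.
  rewrite add0r; apply: bigmax_le => [|j _].
    by apply: sumr_ge0 => k _; rewrite mulr_ge0 ?class_dev_ge0.
  apply: le_trans (level_term_le j (fun k => class_dev_ge0 k Z)).
  rewrite /gap !avgZ -mulrBr ler_wpM2l//.
  have hj : class (lev j) (f j) by left; split.
  have h1 := sup_class_ge 1 Z (ltW H0_gt0) (@class_bounded (lev j)) hj.
  have h2 := sup_class_ge (-1) (~: Z) (ltW H0_gt0) (@class_bounded (lev j)) hj.
  apply: le_trans (lerD h1 h2); lra.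
have := mean_peeling_le (slice_ge0 R u) sum1 h0 fa mean_class_dev.
by move=> /le_trans; apply; have := psi_r_le; lra.
Qed.

(** Recentering adds twice the second moment, at most [2 * 4^k r]. Squaring gives weight [w^2] with
    [w = 4^-k]: one factor cancels [4^k], and [w <= 1] handles the other. The total is
    [2 r + 4 psi r <= 3 r]. *)
Lemma mean_weighted_sq_avg_le : mean (slice u) (max0 (sq_avg phi)) <= 12 * K0 * q.
Proof.
have h0 : 0 <= 2 * psi r by rewrite mulr_ge0.
have fa Z : max0 (sq_avg phi) Z
    <= 2 * r + \sum_(k < L) (1 / 4) ^+ k * sq_class_dev k Z.
  apply: bigmax_le => [|j _].
    apply: addr_ge0; first by rewrite mulr_ge0 ?(ltW r_gt0).
    by apply: sumr_ge0 => k _; rewrite mulr_ge0 ?sq_class_dev_ge0.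
  apply: le_trans (lerD (lexx (2 * r)) (level_term_le j (fun k => sq_class_dev_ge0 k Z))).
  have sqE : (fun i => phi j i ^+ 2)
      = (fun i => ((1 / 4) ^+ lev j) ^+ 2 * (fun i => f j i ^+ 2) i).
    by apply/funext => i; rewrite /phi exprMn.
  rewrite /sq_avg sqE !avgZ -mulrDr.
  have B0 : 0 <= H0 ^+ 2 by rewrite sqr_ge0.
  have hj : sq_class (lev j) (fun i => f j i ^+ 2) by left; exists (f j).
  have h1 := sup_class_ge 1 Z B0 (@sq_class_bounded (lev j)) hj.
  have h2 := sup_class_ge 1 (~: Z) B0 (@sq_class_bounded (lev j)) hj.
  have h3 := T_ge (fH j); have h4 := f_lev j.
  rewrite avgn_sq in h1 h2.
  have h5 := lerD h1 h2; rewrite -/(dev _ _ _) -/(dev _ _ _) -/(sq_class_dev _ _) in h5.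
  set w := (1 / 4) ^+ lev j; set X := avg _ Z + avg _ (~: Z).
  have w0 : 0 <= w by exact: w_ge0.
  have w1 : w <= 1 by exact: w_le1.
  have hX : X <= sq_class_dev (lev j) Z + 2 * (4 ^+ lev j * r) by rewrite /X; lra.
  have D0 := sq_class_dev_ge0 (lev j) Z.
  have W2 : 0 <= w ^+ 2 by rewrite sqr_ge0.
  apply: le_trans (ler_wpM2l W2 hX) _.
  rewrite expr2 -mulrA mulrDr [w * (2 * _)]mulrCA w_level.
  rewrite mulrDr addrC; apply: lerD.
    by rewrite ler_piMl// mulr_ge0 ?(ltW r_gt0).
  by rewrite ler_wpM2l// ler_piMl.
have := mean_peeling_le (slice_ge0 R u) sum1 h0 fa mean_sq_class_dev.
move=> /le_trans; apply.
have h1 := psi_r_le; have h2 : q <= K0 * q by rewrite ler_peMl ?ltW.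
have h3 := q_gt0; rewrite /r; lra.
Qed.

End LocalConcentration.

(** * Numerical constants and the deviation bound *)

Lemma radius_constants_ge (R : realType) (K0 H0 : R) : 0 < K0 -> 0 < H0 ->
  let c0 : R := Num.sqrt 219 in
  1152 * K0 <= 8 * K0 * (4 + 4 * c0 / 7) ^+ 2 /\
  1752 * K0 + 32 * H0 <= 8 * K0 * c0 ^+ 2 + 32 * H0 + c0.
Proof.
move=> K0p H0p c0.
have c0sq : c0 ^+ 2 = 219 by rewrite sqr_sqrtr ?ler0n.
have c00 : 0 <= c0 by rewrite sqrtr_ge0.
(* As [14^2 = 196 <= 219]; this gives [d0 >= 12], and [8 * 12^2 = 1152]. The other constant is
   [8 * 219 = 1752]. *)
have c014 : 14 <= c0.
  rewrite -(ler_pXn2r (ltn0Sn 1)) ?nnegrE ?ler0n// c0sq.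
  by rewrite -natrX ler_nat.
split; last by rewrite c0sq; lra.
have d012 : 12 <= 4 + 4 * c0 / 7 by lra.
set d0 := 4 + _ in d012 *.
have d0sq : 144 <= d0 ^+ 2.
  rewrite (_ : 144 = 12 ^+ 2); last by rewrite -natrX.
  by apply: lerXn2r; rewrite ?nnegrE ?ler0n// (le_trans _ d012)// ler0n.
rewrite (_ : 1152 * K0 = 8 * K0 * 144); last by ring.
by rewrite ler_pM2l// mulr_gt0// ltr0n.
Qed.

Theorem mainTheorem2 (R : realType) (u m : nat) (hu : (2 <= u)%N)
    (hm : (2 <= m)%N)
    (H : set ('I_(u + m) -> R)) (H_nonempty : H !=set0)
    (H0 : R) (H0_gt0 : 0 < H0)
    (H_bounded : forall h, H h -> forall i, `|h i| <= H0)
    (K0 : R) (K0_gt1 : 1 < K0)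
    (T : ('I_(u + m) -> R) -> R)
    (T_ge0 : forall h, H h -> 0 <= T h)
    (T_ge : forall h, H h -> second_moment h <= T h)
    (psi : R -> R) (psi_sub_root : sub_root psi)
    (rs : R) (rs_gt0 : 0 < rs) (rs_fixed : psi rs = rs)
    (psi_ge : forall r, rs <= r ->
       max_complexity u (sublevel H T r) (sq_sublevel H T r) <= psi r) :
  let c0 : R := Num.sqrt 219 in
  let d0 : R := 4 + 4 * c0 / 7 in
  let c1 : R := 8 * K0 * d0 ^+ 2 in
  let c2 : R := 8 * K0 * c0 ^+ 2 + 32 * H0 + c0 in
  forall x : R, 0 < x ->
    1 - expR (- x) <=
    Punif R u (fun Z : {set 'I_(u + m)} => forall h, H h ->
      avg h Z <= avg h (~: Z) + T h / K0 + c1 * rs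
                 + c2 * x / (minn u m)%:R).
Proof.
move=> c0 d0 c1 c2 x x_gt0.
pose N : R := (minn u m)%:R.
have u0 : (0 < u)%N by lia.
have m0 : (0 < m)%N by lia.
have N0 : 0 < N by rewrite ltr0n leq_min u0.
have K0p : 0 < K0 by exact: lt_trans K0_gt1.
have [c1_ge c2_ge] := radius_constants_ge K0p H0_gt0.
pose q := c1 * rs + c2 * x / N.
have y0 : 0 < x / N by rewrite divr_gt0.
have Krs : 0 < K0 * rs by rewrite mulr_gt0.
have q1 : 1152 * K0 * rs <= q.
  have h1 : 1152 * K0 * rs <= c1 * rs by rewrite ler_wpM2r ?(ltW rs_gt0).
  have c2_ge0 : 0 <= c2 by apply: le_trans c2_ge; lra.
  have h2 : 0 <= c2 * (x / N) by rewrite (mulr_ge0 c2_ge0)// ltW.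
  by rewrite /q -(mulrA c2); lra.
have q0 : 0 < q by lra.
have q2 : (1752 * K0 + 32 * H0) * x / N <= q.
  have h1 : 1152 * K0 * rs <= c1 * rs by rewrite ler_wpM2r ?(ltW rs_gt0).
  have h2 : (1752 * K0 + 32 * H0) * (x / N) <= c2 * (x / N).
    by rewrite ler_wpM2r ?(ltW y0).
  by rewrite /q -(mulrA c2) -(mulrA (_ + _) x); lra.
(* The factor [4 K0] makes the rescaled term [T h / K0] alone reach [q] at every positive level. *)
pose r := 4 * K0 * q.
have r0 : 0 < r by rewrite !mulr_gt0.
pose good (Z : {set 'I_(u + m)}) := forall h, H h ->
  avg h Z <= avg h (~: Z) + T h / K0 + q.
(* The family is indexed by all samples, hence finite; a good sample receives an arbitrary member of
   [H]. *)
have wit Z : exists hk : ('I_(u + m) -> R) * nat,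
    [/\ H hk.1, T hk.1 <= 4 ^+ hk.2 * r,
        hk.2 = 0%N \/ 4 ^+ hk.2 * r < 4 * T hk.1 &
        ~ good Z -> avg hk.1 (~: Z) + T hk.1 / K0 + q < avg hk.1 Z].
  have [h [Hh hbad]] : exists h, H h /\
      (~ good Z -> avg h (~: Z) + T h / K0 + q < avg h Z).
    have [gZ|bad] := pselect (good Z).
      by have [h Hh] := H_nonempty; exists h.
    have /existsNP[h /not_implyP[Hh /negP]] := bad.
    by rewrite -ltNge => lt; exists h.
  by have [k [k1 k2]] := exists_level (T h) r0; exists (h, k).
have [hk hkP] := choice wit.
pose f Z := (hk Z).1; pose lev Z := (hk Z).2.
have fH Z : H (f Z) by have [] := hkP Z.
have f_lev Z : T (f Z) <= 4 ^+ lev Z * r by have [] := hkP Z.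
pose phi Z i := (1 / 4) ^+ lev Z * f Z i.
have phi_le Z i : `|phi Z i| <= H0.
  exact: (weighted_bounded H_bounded lev fH).
have Eg : mean (slice u) (max0 (gap phi)) <= q / 4.
  exact: (mean_weighted_gap_le H0_gt0 H_bounded K0_gt1 psi_sub_root rs_gt0
    rs_fixed psi_ge q0 q1 fH f_lev).
have EW : mean (slice u) (max0 (sq_avg phi)) <= 12 * K0 * q.
  exact: (mean_weighted_sq_avg_le H0_gt0 H_bounded K0_gt1 T_ge psi_sub_root
    rs_gt0 rs_fixed psi_ge q0 q1 fH f_lev).
have tail := sup_gap_concentration u0 m0 H0_gt0 phi_le K0p q0 x_gt0 Eg EW q2.
have bad_large Z : ~ good Z -> q <= max0 (gap phi) Z.
  have [_ _ k2 hbad] := hkP Z; move=> /hbad; rewrite -/(f Z) => lt.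
  apply: le_trans (max0_ge (gap phi) Z Z).
  rewrite /gap /phi !avgZ -mulrBr -/(lev Z).
  have w0 : 0 <= (1 / 4 : R) ^+ lev Z by rewrite exprn_ge0// divr_ge0.
  have lt' : T (f Z) / K0 + q <= avg (f Z) Z - avg (f Z) (~: Z) by lra.
  apply: le_trans (ler_wpM2l w0 lt').
  have TK : 0 <= T (f Z) / K0 by rewrite divr_ge0 ?T_ge0// ltW.
  (* At level 0 the weight is 1 and [q] survives. At a positive level [q] is dropped, and
     [r < 4^-k * 4 T] gives [4^-k T / K0 >= q]. *)
  have [k0|{}k2] := k2.
    by rewrite /lev k0 expr0 mul1r; lra.
  rewrite mulrDr; apply: ler_wpDr; first by rewrite mulr_ge0 ?(ltW q0).
  have e : (1 / 4) ^+ lev Z * 4 ^+ lev Z = 1 :> R.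
    by rewrite -exprMn (_ : 1 / 4 * 4 = 1) ?expr1n//; field.
  have h : r <= (1 / 4) ^+ lev Z * (4 * T (f Z)).
    have e2 : (1 / 4) ^+ lev Z * (4 ^+ lev Z * r) = r by rewrite mulrA e mul1r.
    by have := ler_wpM2l w0 (ltW k2); rewrite -/(lev Z) -/(f Z) e2.
  by rewrite mulrA ler_pdivlMr//; move: h; rewrite {1}/r; lra.
rewrite (_ : (fun Z => _) = good); last first.
  by apply/funext => Z; rewrite /good /q -/N; apply/propext; split => hZ h Hh;
    have := hZ h Hh; rewrite !addrA.
(* With total mass 1 split into good and bad samples, it remains to bound the bad mass by the
   tail. *)
rewrite PunifE lerBlDr -(sum_slice R (leq_addr m u)) (bigID (fun Z => `[< good Z >]))/=.
rewrite lerD2l; apply: le_trans tail.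
rewrite big_mkcond [leRHS]big_mkcond/=; apply: ler_sum => Z _.
case: ifPn => [/asboolPn/bad_large ->//|_].
by case: ifP => // _; exact: slice_ge0.
Qed.
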